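(* Consider the equality-constrained convex program $\min\{f(x)\mid Ax=b\}$ and, for $\mu\in(0,1)$, its augmented Lagrangian $L:\mathbb{R}^n\times\mathbb{R}^p\to\mathbb{R}$, $$L(x,\lambda)=f(x)+\frac{1}{2\mu}\lVert Ax-b\rVert^{2}+\langle\lambda,Ax-b\rangle .$$ Suppose that $f\in\mathcal{C}^{1,1}(\mathbb{R}^n,\mathbb{R})$ and $\partial(\nabla f)\succ0$. Then the set $\mathrm{sp}(L)$ of saddle points of $L$ (which is a singleton) is exponentially stable under the saddle-point dynamics $$\dot x=-\nabla_xL(x,\lambda),\qquad\dot\lambda=\nabla_\lambda L(x,\lambda)=Ax-b,\qquad (x(0),\lambda(0))=(x_0,\lambda_0)\in\mathbb{R}^n\times\mathbb{R}^p.$$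
   Context: Standing assumptions: $f:\mathbb{R}^n\to\mathbb{R}$ is convex, $A\in\mathbb{R}^{p\times n}$ with $p\le n$ and $\mathrm{rank}(A)=p$, $b\in\mathbb{R}^p$, and the solution set of $\min\{f(x)\mid Ax=b\}$ is nonempty and bounded. $\mathcal{C}^{1,1}(\mathbb{R}^n,\mathbb{R})$ is the class of continuously differentiable functions $f:\mathbb{R}^n\to\mathbb{R}$ whose gradient $\nabla f$ is locally Lipschitz. The generalized Hessian of such an $f$ at $x$ is $$\partial(\nabla f)(x)=\mathrm{co}\Big\{\lim_{i\to+\infty}\nabla^2f(x_i)\ \Big|\ x_i\to x,\ x_i\notin\Omega\Big\}\subset\mathbb{R}^{n\times n},$$ where $\mathrm{co}$ denotes convex hull and $\Omega$ is the (measure-zero) set of points at which $\nabla f$ is not differentiable; it is a nonempty convex compact set of symmetric matrices. $\partial(\nabla f)\succ0$ means that for every $x\in\mathbb{R}^n$ every matrix in $\partial(\nabla f)(x)$ is positive definite. A saddle point of $L$ is a pair $(x^\star,\lambda^\star)$ with $L(x^\star,\lambda)\le L(x^\star,\lambda^\star)\le L(x,\lambda^\star)$ for all $x\in\mathbb{R}^n$, $\lambda\in\mathbb{R}^p$; $\mathrm{sp}(L)$ is the set of saddle points. Exponential stability of $\mathrm{sp}(L)$, with constants allowed to depend on the region of initial conditions: for every bounded set $B\subset\mathbb{R}^n\times\mathbb{R}^p$ there are constants $c,r>0$ such that every solution with $(x_0,\lambda_0)\in B$ satisfies $\mathrm{dist}((x(t),\lambda(t)),\mathrm{sp}(L))\le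 c\,e^{-rt}\,\mathrm{dist}((x_0,\lambda_0),\mathrm{sp}(L))$ for all $t\ge0$. *)

(* Defs.v *)
(* R^n is the space of column vectors 'cV[R]_n. The library
   norm on matrices is the sup norm; it is used below only for notions that do
   not depend on the choice of the norm (limits, differentiability, bounded
   sets, local Lipschitz continuity). *)
From HB Require Import structures.
From mathcomp Require Import all_boot all_order all_algebra.
From mathcomp Require Import all_classical all_reals all_analysis.

Set Implicit Arguments.
Unset Strict Implicit.
Unset Printing Implicit Defensive.

Import Order.TTheory GRing.Theory Num.Theory.
Import numFieldNormedType.Exports.

Local Open Scope classical_set_scope.
Local Open Scope ring_scope.

Section Euclidean.
Context {R : realType}.

Definition dotp (n : nat) (u v : 'cV[R]_n) : R := \sum_(i < n) u i 0 * v i 0.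

Definition enorm (n : nat) (u : 'cV[R]_n) : R := Num.sqrt (dotp u u).

Definition enorm_pair (n p : nat) (z : 'cV[R]_n * 'cV[R]_p) : R :=
  Num.sqrt (enorm z.1 ^+ 2 + enorm z.2 ^+ 2).

Definition dist_set (n p : nat) (z : 'cV[R]_n * 'cV[R]_p)
    (S : set ('cV[R]_n * 'cV[R]_p)) : R :=
  inf [set enorm_pair (z - s) | s in S].

End Euclidean.

Section GeneralizedHessian.
Context {R : realType} {n : nat}.

(* Partial derivatives; this is the gradient wherever f is differentiable. *)
Definition grad (f : 'cV[R]_n -> R) (x : 'cV[R]_n) : 'cV[R]_n :=
  \col_(i < n) 'D_(delta_mx i 0) f x.

Definition C11 (f : 'cV[R]_n -> R) : Prop :=
  [/\ forall x : 'cV[R]_n, differentiable f x,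
      continuous (grad f)
    & forall x : 'cV[R]_n, exists2 U, nbhs x U & [lipschitz grad f y | y in U]].

Definition hessian (f : 'cV[R]_n -> R) (x : 'cV[R]_n) : 'M[R]_n :=
  \matrix_(i < n, j < n) ('d (grad f) x (delta_mx j 0)) i 0.

Definition convex_hull (V : lmodType R) (S : set V) : set V :=
  \bigcap_(C in [set C : set V | convex_set C /\ S `<=` C]) C.

Definition generalized_hessian (f : 'cV[R]_n -> R) (x : 'cV[R]_n)
    : set 'M[R]_n :=
  convex_hull
    [set H : 'M[R]_n | exists u : nat -> 'cV[R]_n,
       [/\ u @ \oo --> x,
           forall i, differentiable (grad f) (u i)
         & (fun i => hessian f (u i)) @ \oo --> H]].

(* Symmetry is not part of the definition: it holds automatically for the
   elements of generalized_hessian. *)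
Definition posdefmx (M : 'M[R]_n) : Prop :=
  forall v : 'cV[R]_n, v != 0 -> 0 < dotp v (M *m v).

End GeneralizedHessian.

Section SaddlePoints.
Context {R : realType} {n p : nat}.

Definition solution_set (f : 'cV[R]_n -> R) (A : 'M[R]_(p, n)) (b : 'cV[R]_p)
    : set 'cV[R]_n :=
  [set x | A *m x = b /\ forall y, A *m y = b -> f x <= f y].

Definition aug_lagrangian (f : 'cV[R]_n -> R) (A : 'M[R]_(p, n))
    (b : 'cV[R]_p) (mu : R) (x : 'cV[R]_n) (l : 'cV[R]_p) : R :=
  f x + (2 * mu)^-1 * enorm (A *m x - b) ^+ 2 + dotp l (A *m x - b).

Definition saddle_points (L : 'cV[R]_n -> 'cV[R]_p -> R)
    : set ('cV[R]_n * 'cV[R]_p) :=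
  [set z | forall x l, L z.1 l <= L z.1 z.2 /\ L z.1 z.2 <= L x z.2].

(* Classical solution on [0, +oo[ issued from z0; the values of x and l at
   negative times are irrelevant. Since x and l are continuous at 0, the
   one-sided derivative at 0 is determined by the equation at positive times. *)
Definition saddle_solution (L : 'cV[R]_n -> 'cV[R]_p -> R)
    (z0 : 'cV[R]_n * 'cV[R]_p) (x : R -> 'cV[R]_n) (l : R -> 'cV[R]_p) : Prop :=
  [/\ (x 0, l 0) = z0,
      {within `[0, +oo[, continuous x} /\ {within `[0, +oo[, continuous l}
    & forall t : R, 0 < t ->
        is_derive t 1 x (- grad (fun y => L y (l t)) (x t)) /\
        is_derive t 1 l (grad (L (x t)) (l t))].

Definition exponentially_stable (L : 'cV[R]_n -> 'cV[R]_p -> R)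
    (S : set ('cV[R]_n * 'cV[R]_p)) : Prop :=
  forall B : set ('cV[R]_n * 'cV[R]_p), bounded_set B ->
    exists c r : R, [/\ 0 < c, 0 < r &
      forall z0 x l, B z0 -> saddle_solution L z0 x l ->
        forall t : R, 0 <= t ->
          dist_set (x t, l t) S <= c * expR (- r * t) * dist_set z0 S].

End SaddlePoints.

(* Main.v *)
Require Import Defs.
From HB Require Import structures.
From mathcomp Require Import all_boot all_order all_algebra.
From mathcomp Require Import all_classical all_reals all_analysis.
From mathcomp Require Import ring lra.

Set Implicit Arguments.
Unset Strict Implicit.
Unset Printing Implicit Defensive.

Import Order.TTheory GRing.Theory Num.Theory.
Import numFieldNormedType.Exports.

Local Open Scope classical_set_scope.
Local Open Scope ring_scope.

(** Write [F] for the gradient of [f] and [(xs, ls)] for the solution and its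
    Karush-Kuhn-Tucker multiplier, characterized by [A xs = b] and
    [F xs + A^T ls = 0].

    The energy [|x - xs|^2 + |l - ls|^2] does not increase along the flow: its
    derivative is [-2 <x - xs, F x - F xs> - 2/mu |A (x - xs)|^2], and [F] is
    monotone. A trajectory thus stays in a bounded region that depends only on
    the initial data. In this region, suppose that [F] is strongly monotone
    relative to [xs], [<x - xs, F x - F xs> >= m |x - xs|^2], and that
    [|F x - F xs| <= K |x - xs|] ([strong_monotone_bounded], [grad_growth]). The
    derivative of the energy then controls [|x - xs|^2] but not [|l - ls|^2].
    Adding to the energy a small multiple of [<l - ls, A (x - xs)>], whose
    derivative contains [- |A^T (l - ls)|^2], gives a strict Lyapunov function,
    as [A^T] is injective, and Gronwall's lemma yields the exponential decay
    ([energy_exponential_decay]). Strong monotonicity also gives the uniqueness of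
    the saddle point ([saddle_points_singleton]).

    The analytic difficulty is strong monotonicity. Positivity of the generalized
    Hessian at [xs] gives, by compactness, a number [m > 0] and a ball around [xs]
    such that all Hessians at points of that ball where [F] is differentiable are
    at least [m] ([hessian_lower_bound]). To integrate this along a segment one
    needs [F] to be differentiable at almost all points of segments arbitrarily
    close to the given one ([strong_monotone_ball]); this is Rademacher's theorem
    in the form [rademacher_lines]. By convexity of [f], strong monotonicity on a
    small ball around [xs] is enough: farther away the monotonicity of [F] loses
    nothing.

    Rademacher's theorem is proved by induction on the dimension, with densities
    on the line only. Suppose that, for each [t], the slice [h (t, .)] of a
    Lipschitz function is differentiable almost everywhere. By Fubini, for almost
    every [u], the slice is differentiable at [u] for almost every [t]. For fixed
    [u], those [t] at which the slice is approximated, with a given precision, by a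
    given rational linear map at a given scale form a closed set of the line, and
    there are countably many such sets. At a density point [t] of one set for each
    precision, where moreover [h (., u)] is derivable, [h] is differentiable in
    all variables ([eps_diff_density]). The derivability almost everywhere of
    Lipschitz functions of one variable comes from the Radon-Nikodym theorem for
    Stieltjes measures and the Lebesgue differentiation theorem. *)

(** * Lipschitz functions of one real variable *)

Lemma lipschitz_continuous (R : realType) (V W : normedModType R) (h : V -> W) K :
  (forall x y, `|h x - h y| <= K * `|x - y|) -> continuous h.
Proof.
move=> hK x; apply/cvgrPdist_lt => e e0.
have K1 : 0 < `|K| + 1 by rewrite ltr_wpDl.
near=> y; apply: (@le_lt_trans _ _ ((`|K| + 1) * `|x - y|)).
  rewrite (le_trans (hK _ _))// ler_wpM2r//.
  by rewrite (le_trans (ler_norm K))// lerDl.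
rewrite mulrC -ltr_pdivlMr//; near: y.
by apply: (@cvgr_dist_lt _ _ _ (nbhs x) _ id x) => //; exact: divr_gt0.
Unshelve. all: by end_near. Qed.


Section LebesgueStieltjes.
Context {R : realType}.
Local Notation mu := (@lebesgue_measure R).
Local Open Scope ereal_scope.

Lemma stieltjes_itvoc (F : cumulative R R) (a b : R) : (a <= b)%R ->
  lebesgue_stieltjes_measure F `]a, b]%classic = (F b - F a)%:E.
Proof.
move=> ab; rewrite /lebesgue_stieltjes_measure/= /measure_extension/=.
rewrite measurable_mu_extE//=; last exact: is_ocitv.
rewrite wlength_itv/= lte_fin; move: ab; rewrite le_eqVlt => /predU1P[->|->//].
by rewrite ltxx subrr.
Qed.

(** If [G] grows at most as fast as [K id], the Stieltjes measures of [G] and of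
    [K id - G] add up to [K] times the Lebesgue measure, so Lebesgue null sets
    are null for [G]. *)
Lemma stieltjes_dominates (G : cumulative R R) (K : R) : (0 <= K)%R ->
  (forall x y, (x <= y)%R -> (G y - G x <= K * (y - x))%R) ->
  lebesgue_stieltjes_measure G `<< mu.
Proof.
move=> K0 GK.
have GL x y : (`|G x - G y| <= K * `|x - y|)%R.
  wlog xy : x y / (x <= y)%R => [H|].
    by case: (leP x y) => [/H//|/ltW/H]; rewrite distrC (distrC y).
  rewrite distrC (distrC x) !ger0_norm ?subr_ge0//; first exact: GK.
  exact: cumulative_is_nondecreasing.
pose H := fun x : R => (K * x)%R.
have Hnd : nondecreasing H by move=> x y xy; rewrite /H ler_wpM2l.
have Hc : right_continuous H.
  apply: right_continuousW; apply: (@lipschitz_continuous R R R _ (K + K)) => x y.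
  rewrite /H -mulrBr normrM ger0_norm// ler_wpM2r// lerDl//.
pose D := fun x : R => (K * x - G x)%R.
have Dnd : nondecreasing D.
  by move=> x y xy; rewrite /D; have := GK _ _ xy; lra.
have Dc : right_continuous D.
  apply: right_continuousW; apply: (@lipschitz_continuous R R R _ (K + K)) => x y.
  rewrite /D (_ : (_ - _ = K * (x - y) - (G x - G y))%R); last by ring.
  rewrite (le_trans (ler_normB _ _))// mulrDl lerD//.
  by rewrite normrM ger0_norm.
pose Hm : cumulative R R := HB.pack H (isCumulative.Build _ _ _ H Hnd Hc).
pose Dm : cumulative R R := HB.pack D (isCumulative.Build _ _ _ D Dnd Dc).
have HE A : measurable A -> lebesgue_stieltjes_measure Hm A = K%:E * mu A.
  move=> mA.
  rewrite (@lebesgue_stieltjes_measure_unique _ Hm (mscale (NngNum K0) mu))//.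
  move=> X [[a b] _ <-] /=; rewrite /mscale/=.
  have [ab|ba] := leP a b.
    rewrite stieltjes_itvoc//=.
    by rewrite [mu _]stieltjes_itvoc// -EFinM/H mulrBr.
  by rewrite set_itv_ge ?bnd_simp -?leNgt ?(ltW ba)// !measure0 mule0.
have HE2 A : measurable A -> lebesgue_stieltjes_measure Hm A =
    lebesgue_stieltjes_measure G A + lebesgue_stieltjes_measure Dm A.
  move=> mA; rewrite -measure_addE.
  apply: (@lebesgue_stieltjes_measure_unique _ Hm (measure_add _ _)) => //.
  move=> X [[a b] _ <-] /=; rewrite [RHS]measure_addE/=.
  have [ab|ba] := leP a b.
    by rewrite !stieltjes_itvoc//= -EFinD; congr EFin; rewrite /H /D; ring.
  by rewrite set_itv_ge ?bnd_simp -?leNgt ?(ltW ba)// !measure0 adde0.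
apply/null_content_dominatesP => A mA A0.
apply/eqP; rewrite eq_le measure_ge0 andbT.
have := HE2 A mA; rewrite HE// A0 mule0 => ->.
by rewrite leeDl// measure_ge0.
Qed.

(** The Radon-Nikodym density of the Stieltjes measure of [G], restricted to a
    bounded interval so that the measure is finite. *)
Lemma nondecreasing_lipschitz_density (G : R -> R) (K a b : R) :
  (0 <= K)%R -> (a < b)%R ->
  (forall x y, (x <= y)%R -> (0 <= G y - G x <= K * (y - x))%R) ->
  exists phi : R -> R, [/\ (forall t, 0 <= phi t)%R,
    mu.-integrable setT (EFin \o phi) &
    forall x, (a <= x <= b)%R ->
      \int[mu]_(t in `]a, x]) (phi t)%:E = (G x - G a)%:E].
Proof.
move=> K0 ab GK.
have Gnd : nondecreasing G.
  by move=> x y /GK/andP[]; rewrite subr_ge0.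
have Gc : right_continuous G.
  apply: right_continuousW; apply: (@lipschitz_continuous R R R _ K) => x y.
  case: (leP x y) => [xy|/ltW xy].
    have /andP[? ?] := GK _ _ xy.
    by rewrite distrC (distrC x) !ger0_norm ?subr_ge0// -subr_ge0.
  by have /andP[? ?] := GK _ _ xy; rewrite !ger0_norm ?subr_ge0// -subr_ge0.
pose Gm : cumulative R R := HB.pack G (isCumulative.Build _ _ _ G Gnd Gc).
have mab : measurable (`]a, b]%classic : set (measurableTypeR R)).
  exact: measurable_itv.
have fab : lebesgue_stieltjes_measure Gm `]a, b]%classic < +oo.
  by rewrite stieltjes_itvoc ?(ltW ab)// ltry.
pose nu := mfrestr mab fab.
have dom : nu `<< mu.
  have /null_content_dominatesP : lebesgue_stieltjes_measure Gm `<< mu.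
    by apply: (stieltjes_dominates K0) => x y /GK /andP[].
  move=> h; apply/null_content_dominatesP => A mA A0.
  rewrite /nu/= /mfrestr/= /mrestr/=.
  apply: h; first exact: measurableI.
  apply/eqP; rewrite eq_le measure_ge0 andbT -A0.
  by rewrite le_measure ?inE//; exact: measurableI.
have [f [f0 ffin fint fE]] := radon_nikodym_sigma_finite dom.
have fineE t : (fine (f t))%:E = f t by rewrite fineK.
exists (fine \o f); split.
- by move=> t; rewrite -lee_fin fineE.
- by apply: eq_integrable fint => // t _; rewrite /= fineE.
- move=> x /andP[ax xb].
  under eq_integral do rewrite fineE.
  rewrite -fE; last exact: measurable_itv.
  rewrite /nu/= /mfrestr/= /mrestr/= (_ : _ `&` _ = `]a, x]%classic).
    by rewrite stieltjes_itvoc.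
  apply/seteqP; split => t /=; rewrite !in_itv/=; first by case.
  by move=> /andP[-> tx]; rewrite tx (le_trans tx).
Qed.

End LebesgueStieltjes.

Section LipschitzLine.
Context {R : realType}.
Local Notation mu := (@lebesgue_measure R).

(** Adding [K id] to a [K]-Lipschitz function makes it nondecreasing; Lebesgue
    points of the density of the sum are points of derivability. *)
Lemma lipschitz_density (g : R -> R) (K a b : R) : 0 <= K -> a < b ->
  (forall x y, `|g x - g y| <= K * `|x - y|) ->
  exists phi : R -> R, [/\ forall t, 0 <= phi t,
    mu.-integrable setT (EFin \o phi),
    (\int[mu]_(t in `]a, b]) (phi t)%:E = (g b + K * b - (g a + K * a))%:E)%E &
    {ae mu, forall x, a < x < b -> derivable g x 1 /\ 'D_1 g x = phi x - K}].
Proof.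
move=> K0 ab gK; pose G := fun x => g x + K * x.
have GK x y : x <= y -> 0 <= G y - G x <= (K + K) * (y - x).
  move=> xy; have := gK x y; rewrite distrC (distrC x) (ger0_norm (_ : 0 <= y - x)) ?subr_ge0//.
  rewrite ler_norml /G => /andP[h1 h2]; apply/andP; split; nra.
have [phi [phi0 phii phiE]] :=
  nondecreasing_lipschitz_density (addr_ge0 K0 K0) ab GK.
exists phi; split=> //; first by rewrite phiE// (ltW ab) lexx.
have loc : locally_integrable [set: R] phi.
  have := integrable_locally measurableT phii.
  by rewrite patch_setT.
have iS (A : set R) : measurable A -> mu.-integrable A (EFin \o phi).
  by move=> mA; apply: integrableS phii.
have := FTC1 (fun y => iS _ (measurable_itv (Interval (BRight a) (BRight y)))) loc.
apply: filterS; first exact: (ae_filter_ringOfSetsType mu).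
move=> x /= h /andP[ax xb].
have /h[dF F'] : (BRight a < BRight x)%O by rewrite bnd_simp.
pose F := fun x => \int[mu]_(t in `]a, x]) phi t.
have gE : \forall y \near x, g y = F y - K * y + G a.
  near=> y; have [ay yb] : a < y /\ y < b.
    split; near: y; [exact: lt_nbhsr|exact: lt_nbhsl].
  rewrite /F /Rintegral phiE ?(ltW ay) ?(ltW yb)//= /G; ring.
have dF' : is_derive x (1:R) (fun y => F y - K * y + G a) (phi x - K).
  move: F'; rewrite derive1E => F'.
  have dFx : is_derive x (1:R) F (phi x) by exact: DeriveDef dF F'.
  have -> : (fun y => F y - K * y + G a) = F - K \*: id + cst (G a) by [].
  have -> : phi x - K = phi x - K *: (1 : R) + 0 by rewrite addr0 /GRing.scale/= mulr1.
  by apply: is_deriveD.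
have [] : is_derive x (1 : R) g (phi x - K) => //.
by apply: near_eq_is_derive dF'; apply: filterS gE => y ->.
Unshelve. all: by end_near. Qed.

Lemma lipschitz_ae_derivable (g : R -> R) (K : R) :
  (forall x y, `|g x - g y| <= K * `|x - y|) ->
  {ae mu, forall x, derivable g x 1}.
Proof.
move=> gK; have K0 : 0 <= K.
  by have := le_trans (normr_ge0 _) (gK 1 0); rewrite subr0 normr1 mulr1.
have : {ae mu, forall x, forall k : nat, - k.+1%:R < x < k.+1%:R -> derivable g x 1}.
  apply/ae_foralln => k.
  have kk : - k.+1%:R < k.+1%:R :> R by rewrite gtrN.
  have [phi [_ _ _]] := lipschitz_density K0 kk gK.
  by apply: filterS; first exact: (ae_filter_ringOfSetsType mu); move=> x h /h [].
apply: filterS; first exact: (ae_filter_ringOfSetsType mu).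
move=> x /(_ (Num.truncn `|x|)); apply.
by rewrite -ltr_norml; exact: truncnS_gt.
Qed.

(** A Lipschitz function is the integral of its derivative. Adding [K id] makes
    both integrands nonnegative, so that they can be compared almost
    everywhere; the maximum with [0] covers the case [c + K < 0]. *)
Lemma lipschitz_ae_derive_ge (g : R -> R) (K c a b : R) :
  (forall x y, `|g x - g y| <= K * `|x - y|) -> a < b ->
  {ae mu, forall x, a < x < b -> derivable g x 1 -> c <= 'D_1 g x} ->
  c * (b - a) <= g b - g a.
Proof.
move=> gK ab gc; have K0 : 0 <= K.
  by have := le_trans (normr_ge0 _) (gK 1 0); rewrite subr0 normr1 mulr1.
have [phi [phi0 phii phiE phid]] := lipschitz_density K0 ab gK.
have iphi : mu.-integrable (`]a, b[%classic : set R) (EFin \o phi).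
  by apply: integrableS phii => //; exact: measurable_itv.
have mphi := measurable_int _ iphi.
have : (\int[mu]_(t in `]a, b[) (Num.max (c + K) 0)%:E <=
        \int[mu]_(t in `]a, b[) (phi t)%:E)%E.
  apply: ae_ge0_le_integral => //.
  - by move=> x _; rewrite lee_fin le_max lexx orbT.
  - by move=> x _; rewrite lee_fin.
  - move: gc phid; apply: filterS2; first exact: (ae_filter_ringOfSetsType mu).
    move=> x h1 h2 /=; rewrite in_itv/= => xab.
    have [dg g'] := h2 xab; have := h1 xab dg; rewrite g' => h.
    by rewrite lee_fin ge_max phi0 andbT -lerBrDr.
rewrite integral_cst//= lebesgue_measure_itv/= lte_fin ab -EFinD -EFinM.
rewrite (_ : (\int[mu]_(t in `]a, b[) _ = \int[mu]_(t in `]a, b]) (phi t)%:E)%E); last first.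
  by rewrite integral_itv_bndo_bndc//; exact: mphi.
rewrite phiE lee_fin => h.
have : (c + K) * (b - a) <= Num.max (c + K) 0 * (b - a).
  by rewrite ler_wpM2r ?subr_ge0 ?(ltW ab)// le_max lexx.
move: h; lra.
Qed.

End LipschitzLine.

(** * Column vectors and approximate differentiability *)

Section ColumnVectors.
Context {R : realType}.

Lemma normm_entry m n (M : 'M[R]_(m, n)) i j : `|M i j| <= `|M|.
Proof. by rewrite [leRHS]/Num.norm/= mx_normrE; exact: (le_bigmax _ _ (i, j)). Qed.

Lemma normm_le m n (M : 'M[R]_(m, n)) e : 0 <= e ->
  (forall i j, `|M i j| <= e) -> `|M| <= e.
Proof.
by move=> e0 h; rewrite [leLHS]/Num.norm/= mx_normrE; apply: bigmax_le => // -[].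
Qed.

Lemma dotpDr n (u v w : 'cV[R]_n) : dotp u (v + w) = dotp u v + dotp u w.
Proof. by rewrite -big_split; apply: eq_bigr => i _; rewrite mxE mulrDr. Qed.

Lemma dotpC n (u v : 'cV[R]_n) : dotp u v = dotp v u.
Proof. by apply: eq_bigr => i _; rewrite mulrC. Qed.

Lemma dotpZr n a (u v : 'cV[R]_n) : dotp u (a *: v) = a * dotp u v.
Proof. by rewrite mulr_sumr; apply: eq_bigr => i _; rewrite mxE; ring. Qed.

Lemma dotpDl n (u v w : 'cV[R]_n) : dotp (v + w) u = dotp v u + dotp w u.
Proof. by rewrite dotpC dotpDr !(dotpC u). Qed.

Lemma dotpZl n a (u v : 'cV[R]_n) : dotp (a *: v) u = a * dotp v u.
Proof. by rewrite dotpC dotpZr dotpC. Qed.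

Lemma dotpNr n (u v : 'cV[R]_n) : dotp u (- v) = - dotp u v.
Proof. by rewrite -scaleN1r dotpZr mulN1r. Qed.

Lemma dotpNl n (u v : 'cV[R]_n) : dotp (- v) u = - dotp v u.
Proof. by rewrite dotpC dotpNr dotpC. Qed.

Lemma dotp_norm_le n (u v : 'cV[R]_n) : `|dotp u v| <= n%:R * `|u| * `|v|.
Proof.
rewrite (le_trans (ler_norm_sum _ _ _))//.
apply: (@le_trans _ _ (\sum_(i < n) `|u| * `|v|)).
  by apply: ler_sum => i _; rewrite normrM ler_pM// normm_entry.
by rewrite sumr_const card_ord -[leLHS]mulr_natl mulrA.
Qed.

(** Points of [R^(1+k)] as a first coordinate, along which lines are drawn, and
    the column of the others. *)
Definition pt k (t : R) (u : 'cV[R]_k) : 'cV[R]_(1 + k) := col_mx t%:M u.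

Lemma ptD k t s (u v : 'cV[R]_k) : pt t u + pt s v = pt (t + s) (u + v).
Proof. by rewrite /pt add_col_mx -raddfD. Qed.

Lemma ptB k t s (u v : 'cV[R]_k) : pt t u - pt s v = pt (t - s) (u - v).
Proof. by rewrite /pt opp_col_mx add_col_mx -raddfB. Qed.

Lemma pt_surj k (w : 'cV[R]_(1 + k)) : w = pt (w 0 0) (dsubmx w).
Proof.
rewrite -[LHS]vsubmxK; congr col_mx; apply/matrixP => i j.
by rewrite !ord1 !mxE eqxx mulr1n; congr (w _ _); exact/val_inj.
Qed.

Lemma norm_pt_le k t (u : 'cV[R]_k) e : `|t| <= e -> `|u| <= e -> `|pt t u| <= e.
Proof.
move=> te ue; apply: normm_le => [|i j]; first exact: le_trans te.
rewrite ord1 /pt; case: (split_ordP i) => l ->.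
  by rewrite col_mxEu mxE !ord1 eqxx mulr1n.
by rewrite col_mxEd (le_trans (normm_entry _ _ _)).
Qed.

Lemma norm_pt_fst k t (u : 'cV[R]_k) : `|t| <= `|pt t u|.
Proof.
by have := normm_entry (pt t u) (lshift k 0) 0; rewrite /pt col_mxEu mxE eqxx mulr1n.
Qed.

Lemma norm_pt_snd k t (u : 'cV[R]_k) : `|u| <= `|pt t u|.
Proof.
apply: normm_le => // i j.
by have := normm_entry (pt t u) (rshift 1 i) j; rewrite /pt col_mxEd.
Qed.

Lemma dotp_pt k s t (u v : 'cV[R]_k) : dotp (pt s u) (pt t v) = s * t + dotp u v.
Proof.
rewrite /dotp big_split_ord/= big_ord1 !col_mxEu !mxE !mulr1n; congr (_ + _).
by apply: eq_bigr => i _; rewrite !col_mxEd.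
Qed.

End ColumnVectors.

Section EpsDifferentiability.
Context {R : realType}.

(** Candidate derivatives [am.1] are rational, and the tolerance and the radius
    are reciprocals of integers: differentiability of [h] along the image of
    [iota] is then a countable combination of closed conditions, which settles
    all questions of measurability. *)
Definition affine_approx (V : normedModType R) l (iota : 'cV[R]_l -> V)
    (h : V -> R) (j : nat) (am : 'cV[rat]_l * nat) : set V :=
  [set x | forall u : 'cV[R]_l, `|u| <= am.2.+1%:R^-1 ->
     `|h (x + iota u) - h x - dotp (map_mx ratr am.1) u| <= j.+1%:R^-1 * `|u|].

Definition eps_diff (V : normedModType R) l (iota : 'cV[R]_l -> V) (h : V -> R)
    (x : V) := forall j, exists am, affine_approx iota h j am x.

Lemma closed_affine_approx (V : normedModType R) l (iota : 'cV[R]_l -> V) h j am :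
  continuous h -> closed (affine_approx iota h j am).
Proof.
move=> ch.
rewrite (_ : affine_approx _ _ _ _ = \bigcap_(u in [set u : 'cV[R]_l |
    `|u| <= am.2.+1%:R^-1]) [set x | `|h (x + iota u) - h x -
      dotp (map_mx ratr am.1) u| <= j.+1%:R^-1 * `|u|]); last by apply/seteqP; split.
apply: closed_bigI => u _.
apply: (@preimage_closed _ _ (fun x => `|h (x + iota u) - h x -
      dotp (map_mx ratr am.1) u|) [set y : R | y <= _]); last exact: closed_le.
move=> x _; apply: cvg_norm.
apply: cvgB; last exact: cvg_cst.
apply: cvgB; last exact: ch.
apply: (@continuous_comp _ _ _ (fun x => x + iota u) h); last exact: ch.
by apply: cvgD; [exact: cvg_id|exact: cvg_cst].
Qed.

Lemma rat_dense (x e : R) : 0 < e -> exists q : rat, `|x - ratr q| < e.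
Proof.
move=> e0; have [|y [xy [q _ qy]]] := @dense_rat R (ball x e) _ (ball_open x e).
  by exists x; exact: ballxx.
by exists q; rewrite qy; exact: xy.
Qed.

End EpsDifferentiability.

(** * Null sets and density points *)

Section NullSets.
Context {R : realType}.
Local Notation mu := (@lebesgue_measure R).

Lemma ae_forall_countable d (T : measurableType d)
    (nu : {measure set T -> \bar R}) (I : countType) (P : I -> T -> Prop) :
  (forall i, {ae nu, forall x, P i x}) -> {ae nu, forall x, forall i, P i x}.
Proof.
move=> aeP.
have : {ae nu, forall x, forall n : nat, forall i : I, pickle i = n -> P i x}.
  apply/ae_foralln => n; have [[i <-]|noi] := pselect (exists i : I, pickle i = n).
    apply: filterS (aeP i).
    by move=> x Px i' /(pcan_inj (@pickleK I)) ->.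
  by apply: aeW => /= x i ni; exfalso; apply: noi; exists i.
apply: filterS.
by move=> x h i; exact: h erefl.
Qed.

(** Tonelli's theorem for an indicator function; it turns information on slices
    into information on lines. *)
Lemma null_ysection_xsection d1 d2 (T1 : measurableType d1)
    (T2 : measurableType d2) (m1 : {sigma_finite_measure set T1 -> \bar R})
    (m2 : {sigma_finite_measure set T2 -> \bar R}) (N : set (T1 * T2)) :
  measurable N -> (forall y, m1 (ysection N y) = 0%E) ->
  {ae m1, forall x, m2 (xsection N x) = 0%E}.
Proof.
move=> mN N0; have := indic_fubini_tonelli m1 m2 mN.
rewrite indic_fubini_tonelli_FE// indic_fubini_tonelli_GE//.
rewrite (eq_integral (cst 0%E) (m1 \o ysection N)); last by move=> y _ /=; rewrite N0.
rewrite integral0 => int0.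
have /(@ae_eq_integral_abs _ _ _ m1 _ measurableT _ (measurable_fun_xsection m2 mN)).1 :
    (\int[m1]_x `|(m2 \o xsection N) x| = 0)%E.
  by rewrite -[RHS]int0; apply: eq_integral => x _; rewrite gee0_abs.
apply: filterS.
by move=> x; exact.
Qed.

(** Around a density point no gap of the set has a length comparable to its
    distance to the point: an interval of radius [e |s|] around [t + s] that
    misses the set would keep the density in the ball of radius [2 |s|] below
    [1 - e / 2]. *)
Lemma lebesgue_density_porosity (S : set R) (t : R) :
  measurable S -> S t ->
  (mu (S `&` ball t r) * (mu (ball t r))^-1 @[r --> 0^'+] --> (\1_S t)%:E)%E ->
  forall e, 0 < e -> exists2 dl, 0 < dl & forall s, `|s| < dl ->
    exists2 s', `|s - s'| <= e * `|s| & S (t + s').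
Proof.
move=> mS St; rewrite indicE mem_set//= => dens e e0.
wlog e1 : e e0 / e <= 1 => [H|].
  have e1 : 0 < Num.min e 1 by rewrite lt_min e0/=.
  have e1_le : Num.min e 1 <= 1 by rewrite ge_min lexx orbT.
  have [dl dl0 h] := H (Num.min e 1) e1 e1_le.
  exists dl => // s /h[s' ss' Ss']; exists s' => //.
  by rewrite (le_trans ss')// ler_wpM2r// ge_min lexx.
have : \forall r \near 0^'+, ((1 - e / 2)%:E < mu (S `&` ball t r) * (mu (ball t r))^-1)%E.
  have lt1 : ((1 - e / 2)%:E < 1%:E)%E by rewrite lte_fin ltrBlDr ltrDl divr_gt0.
  exact: (dens _ (open_ereal_gt' lt1)).
move=> [/= dl dl0 near].
exists (dl / 2); first exact: divr_gt0.
move=> s sdl; have [->|s0] := eqVneq s 0.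
  by exists 0; rewrite ?addr0// subrr normr0 mulr0.
apply: contrapT => noS.
have as0 : 0 < `|s| by rewrite normr_gt0.
pose r := `|s| *+ 2.
have r0 : 0 < r by rewrite pmulrn_lgt0.
have rdl : `|0 - r| < dl.
  by rewrite sub0r normrN gtr0_norm// /r -mulr_natr -ltr_pdivlMr.
have := near r rdl r0; rewrite ltNge => /negP; apply.
have es0 : 0 < e * `|s| by rewrite mulr_gt0.
have sub : S `&` ball t r `<=` ball t r `\` ball (t + s) (e * `|s|).
  move=> y [Sy ty]; split=> // sy; apply: noS; exists (y - t).
    move: sy; rewrite /ball/= => /ltW; rewrite opprB addrA (addrC s)//.
  by rewrite addrC subrK.
have sub2 : ball (t + s) (e * `|s|) `<=` ball t r.
  move=> y; rewrite /ball/= => ty; rewrite (_ : t - y = (t + s - y) - s); last by ring.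
  rewrite (le_lt_trans (ler_normB _ _))// /r mulr2n ltr_leD//.
  by rewrite (lt_le_trans ty)// ler_piMl.
have mball (x rad : R) : measurable (ball x rad : set (measurableTypeR R)).
  exact: measurable_realfun.measurable_ball.
have : (mu (S `&` ball t r) <= (r *+ 2 - (e * `|s|) *+ 2)%:E)%E.
  apply: (@le_trans _ _ (mu (ball t r `\` ball (t + s) (e * `|s|)))).
    apply: le_measure; rewrite ?inE//.
      exact: measurableI.
    exact: measurableD.
  rewrite measureD//=; last by rewrite lebesgue_measure_ball ?ltry// ltW.
  rewrite setIidr// !lebesgue_measure_ball//; exact: ltW.
have r2 : r *+ 2 == 0 = false by rewrite gt_eqF// pmulrn_lgt0.
rewrite lebesgue_measure_ball ?(ltW r0)// inver r2.
move=> h; apply: le_trans (lee_pmul _ _ h (lexx _)) _ => //.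
  by rewrite lee_fin invr_ge0 mulrn_wge0// ltW.
rewrite -EFinM lee_fin ler_pdivrMr ?pmulrn_lgt0// /r; lra.
Qed.

End NullSets.

(** * Rademacher's theorem *)

Section Slices.
Context {R : realType}.
Local Notation mu := (@lebesgue_measure R).

(** For each precision, [h] is almost affine in the last coordinates, with one
    slope and at one scale, at the points [(t', u0)] with [t'] in a set without
    large gaps around [t]. An increment [(s, u)] is split into [s] followed by [u]; the second part is estimated from
    a point of the set at distance at most [e |s|] from [t + s], and the
    Lipschitz constant pays for that displacement. *)
Lemma eps_diff_density k (h : 'cV[R]_(1 + k) -> R) K (u0 : 'cV[R]_k) (t : R) :
  0 <= K -> (forall x y, `|h x - h y| <= K * `|x - y|) ->
  (forall j, exists2 am, affine_approx (pt 0) h j am (pt t u0) &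
    forall e, 0 < e -> exists2 dl, 0 < dl & forall s, `|s| < dl ->
      exists2 s', `|s - s'| <= e * `|s| &
        affine_approx (pt 0) h j am (pt (t + s') u0)) ->
  derivable (fun t => h (pt t u0)) t 1 ->
  eps_diff id h (pt t u0).
Proof.
move=> K0 hK slices dh J.
(* the five errors below: two displacements by the Lipschitz constant, the slice,
   the derivative in the first coordinate, and its rational approximation *)
have [j hj] : exists j : nat, (K + K + 3) * j.+1%:R^-1 <= J.+1%:R^-1.
  exists (Num.truncn ((K + K + 3) * J.+1%:R)).
  by rewrite ler_pdivrMr// mulrC ler_pdivlMr// ltW// truncnS_gt.
have e0 : 0 < j.+1%:R^-1 :> R by rewrite invr_gt0.
have [[a m] /= _ por] := slices j.
have [dl dl0 {}por] := por _ e0.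
pose g := fun t => h (pt t u0).
(* the slope in the first coordinate must be rational as well *)
have [q Dq] := rat_dense ('D_1 g t) e0.
have [d1 d10 hd1] : exists2 d1, 0 < d1 & forall s, `|s| < d1 ->
    `|g (t + s) - g t - 'D_1 g t * s| <= j.+1%:R^-1 * `|s|.
  have /eqaddoP/(_ _ e0)/nbhs_ballP[d1 d10 hd1] := derivable_nbhs dh.
  exists d1 => // s sd1.
  have := hd1 s; rewrite /ball/= sub0r normrN => /(_ sd1).
  by rewrite !fctE/= /shift/= /GRing.scale/= mulr1 (addrC t) (mulrC s) opprD addrA.
have [M hM] : exists M : nat, M.+1%:R^-1 < Num.min dl (Num.min d1 m.+1%:R^-1) :> R.
  exists (Num.truncn (Num.min dl (Num.min d1 m.+1%:R^-1))^-1).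
  by rewrite invf_plt ?posrE ?truncnS_gt// !lt_min dl0 d10 invr_gt0/=.
exists (col_mx q%:M a, M) => w /= wM.
have wlt : `|w| < Num.min dl (Num.min d1 m.+1%:R^-1) by exact: le_lt_trans hM.
move: wlt; rewrite !lt_min => /and3P[wdl wd1 wm].
set s := w 0 0; set u := dsubmx w; have wE : w = pt s u by exact: pt_surj.
have sw : `|s| <= `|w| by rewrite wE norm_pt_fst.
have uw : `|u| <= `|w| by rewrite wE norm_pt_snd.
have [s' ss' as'] := por s (le_lt_trans sw wdl).
have := as' u; rewrite /= ptD addr0 => /(_ (le_trans uw (ltW wm))) h2.
have h1 := hd1 s (le_lt_trans sw wd1); rewrite /g in h1.
have -> : map_mx ratr (col_mx q%:M a) = pt (ratr q) (map_mx ratr a) :> 'cV[R]_(1 + k).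
  rewrite /pt map_col_mx; congr col_mx; apply/matrixP => ? ?.
  by rewrite !ord1 !mxE eqxx !mulr1n.
rewrite wE dotp_pt ptD -wE.
have lip v : `|h (pt (t + s) v) - h (pt (t + s') v)| <= K * (j.+1%:R^-1 * `|s|).
  rewrite (le_trans (hK _ _))// ler_wpM2l// ptB subrr opprD addrACA subrr add0r.
  by rewrite (le_trans (norm_pt_le (lexx _) _))// normr0.
have h3 := lip (u0 + u); have h4 := lip u0.
have h5 : `|('D_1 g t - ratr q) * s| <= j.+1%:R^-1 * `|s|.
  by rewrite normrM ler_wpM2r// ltW.
apply: (@le_trans _ _ ((K + K + 3) * j.+1%:R^-1 * `|w|)); last by rewrite ler_wpM2r.
have sw' : j.+1%:R^-1 * `|s| <= j.+1%:R^-1 * `|w| by rewrite ler_wpM2l// ltW.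
have uw' : j.+1%:R^-1 * `|u| <= j.+1%:R^-1 * `|w| by rewrite ler_wpM2l// ltW.
have Ksw : K * (j.+1%:R^-1 * `|s|) <= K * (j.+1%:R^-1 * `|w|) by rewrite ler_wpM2l.
move: h1 h2 h3 h4 h5 sw' uw' Ksw; clear.
set X1 := h (pt (t + s) (u0 + u)); set X2 := h (pt (t + s') (u0 + u)).
set X3 := h (pt (t + s) u0); set X4 := h (pt (t + s') u0); set X5 := h (pt t u0).
set e := _^-1; rewrite mulrBl.
set ds := _ * s; set qs := _ * s; set ad := dotp _ _.
set es := e * `|s|; set eu := e * `|u|; rewrite -[(K + K + 3) * e * _]mulrA.
set ew := e * `|w|; rewrite !ler_norml; lra.
Qed.

Lemma ae_eps_diff_line k (h : 'cV[R]_(1 + k) -> R) K (u0 : 'cV[R]_k) :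
  0 <= K -> (forall x y, `|h x - h y| <= K * `|x - y|) ->
  {ae mu, forall t, eps_diff (pt 0) h (pt t u0)} ->
  {ae mu, forall t, eps_diff id h (pt t u0)}.
Proof.
move=> K0 hK slices.
have ptK (t s : R) : `|pt t u0 - pt s u0| <= `|t - s|.
  by rewrite ptB subrr norm_pt_le// normr0.
have cpt : continuous (fun t : R => pt t u0).
  by apply: (@lipschitz_continuous _ _ _ _ 1) => x y; rewrite mul1r.
have dens : {ae mu, forall t, forall j : nat * ('cV[rat]_k * nat),
    let S := (fun t : R => pt t u0) @^-1` affine_approx (pt 0) h j.1 j.2 in
    (mu (S `&` ball t r) * (mu (ball t r))^-1 @[r --> 0^'+] --> (\1_S t)%:E)%E}.
  apply: ae_forall_countable => -[j am] /=.
  apply: lebesgue_density; apply: measurable_realfun.closed_measurable.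
  apply: preimage_closed => [x _|]; first exact: cpt.
  exact/closed_affine_approx/(lipschitz_continuous hK).
have dh : {ae mu, forall t, derivable (fun t : R => h (pt t u0)) t 1}.
  apply: (@lipschitz_ae_derivable _ _ K) => x y.
  by rewrite (le_trans (hK _ _))// ler_wpM2l.
move: slices dens dh; apply: filterS3; first exact: (ae_filter_ringOfSetsType mu).
move=> t sl dens dh; apply: (eps_diff_density K0 hK) => // j.
have [am ham] := sl j; exists am => // e e0.
have [|//|dl dl0 hdl] := lebesgue_density_porosity _ _ (dens (j, am)) e0.
  apply: measurable_realfun.closed_measurable.
  apply: preimage_closed => [x _|]; first exact: cpt.
  exact/closed_affine_approx/(lipschitz_continuous hK).
by exists dl.
Qed.

End Slices.

(** The product measure bundled as a sigma-finite measure, so that products can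
    be iterated. *)
Lemma product_sigma_finite (R : realType) d1 d2 (T1 : measurableType d1)
    (T2 : measurableType d2) (m1 : {sigma_finite_measure set T1 -> \bar R})
    (m2 : {sigma_finite_measure set T2 -> \bar R}) :
  exists m : {sigma_finite_measure set (T1 * T2)%type -> \bar R},
    (m : set _ -> \bar R) = (m1 \x m2)%E.
Proof.
have sf : sigma_finite setT (m1 \x m2)%E.
  have [F TF Foo] := sigma_finiteT m1; have [G TG Goo] := sigma_finiteT m2.
  exists (fun n => if unpickle n is Some ij then F ij.1 `*` G ij.2 else set0).
    apply/esym/seteqP; split=> // -[x y] _.
    have [i _ Fix] : (\bigcup_i F i) x by rewrite -TF.
    have [j _ Gjy] : (\bigcup_i G i) y by rewrite -TG.
    by exists (pickle (i, j)) => //; rewrite pickleK.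
  move=> n; case: unpickle => [[i j]|]/=; last by rewrite measure0.
  have [? ?] := Foo i; have [? ?] := Goo j; split; first exact: measurableX.
  by rewrite product_measure1E// lte_mul_pinfty// ge0_fin_numE.
pose m : {sigma_finite_measure set (T1 * T2)%type -> \bar R} :=
  HB.pack (product_measure1 m1 m2)
    (Measure_isSigmaFinite.Build _ _ _ (m1 \x m2)%E sf).
by exists m.
Qed.

Section Rademacher.
Context {R : realType}.
Local Notation leb := (@lebesgue_measure R).

(** Lebesgue measure on [R^k], seen through a parametrization [phi] by an
    iterated product of lines. Taking any measurable space [T] as the source
    avoids choosing a sigma-algebra on column vectors. *)
Definition ae_differentiates k d (T : measurableType d)
    (nu : {sigma_finite_measure set T -> \bar R}) (phi : T -> 'cV[R]_k) :=
  [/\ forall O, open O -> measurable (phi @^-1` O),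
      forall y e, 0 < e -> nu (phi @^-1` ball y e) != 0%E &
      forall h K, 0 <= K -> (forall x y, `|h x - h y| <= K * `|x - y|) ->
        {ae nu, forall s, eps_diff id h (phi s)}].

Lemma pt_lipschitz k (t s : R) (u v : 'cV[R]_k) e :
  `|t - s| < e -> `|u - v| < e -> `|pt t u - pt s v| < e.
Proof.
move=> ts uv; rewrite ptB; apply: le_lt_trans (_ : Num.max `|t - s| `|u - v| < e).
  by apply: norm_pt_le; rewrite le_max lexx ?orbT.
by rewrite gt_max ts.
Qed.

(** An open set of the product is a countable union of products of an open set
    with a ball of rational centre and radius. *)
Lemma measurable_pt_preimage k d (T : measurableType d) (phi : T -> 'cV[R]_k) O :
  (forall O, open O -> measurable (phi @^-1` O)) -> open O ->
  measurable [set z : T * measurableTypeR R | O (pt z.2 (phi z.1))].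
Proof.
move=> mphi oO.
pose A (qm : rat * nat) : set 'cV[R]_k :=
  [set u | forall t : R, `|t - ratr qm.1| < qm.2.+1%:R^-1 -> O (pt t u)].
rewrite (_ : [set z | _] = \bigcup_qm
    ((phi @^-1` (A qm)^°) `*` (ball (ratr qm.1 : R) qm.2.+1%:R^-1))); last first.
  apply/seteqP; split => [[s t] /= Ost|[s t] [[q m] _ [/= As]]]; last first.
    by rewrite /ball/= distrC; exact: (interior_subset As).
  move: oO; rewrite openE => /(_ _ Ost) /nbhs_ballP[e /= e0 he].
  have [m hm] : exists m : nat, m.+1%:R^-1 < e / 2 :> R.
    exists (Num.truncn (e / 2)^-1).
    by rewrite invf_plt ?posrE ?truncnS_gt// divr_gt0.
  have m0 : 0 < m.+1%:R^-1 :> R by rewrite invr_gt0.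
  have [q tq] := rat_dense t m0.
  exists (q, m) => //; split => /=; last by rewrite /ball/= distrC.
  apply/nbhs_ballP; exists e => //= u su t' t'q; apply: he.
  rewrite -ball_normE/=; apply: pt_lipschitz; last by move: su; rewrite -ball_normE.
  rewrite (_ : t - t' = (t - ratr q) - (t' - ratr q)); last by ring.
  by rewrite (le_lt_trans (ler_normB _ _))// (splitr e) ltrD// (lt_trans _ hm).
apply: countable_bigcupT_measurable; first exact: countableP.
move=> qm; apply: measurableX; first exact/mphi/open_interior.
exact: measurable_realfun.measurable_ball.
Qed.

Lemma eps_diff_pt k (h : 'cV[R]_(1 + k) -> R) (t : R) (u : 'cV[R]_k) :
  eps_diff id (fun v => h (pt t v)) u -> eps_diff (pt 0) h (pt t u).
Proof.
move=> d j; have [am ham] := d j; exists am => v vm.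
by rewrite ptD addr0; exact: ham.
Qed.

Lemma measurable_eps_diff (V : normedModType R) l (iota : 'cV[R]_l -> V)
    (h : V -> R) d (T : measurableType d) (psi : T -> V) :
  (forall O, open O -> measurable (psi @^-1` O)) -> continuous h ->
  measurable [set z | eps_diff iota h (psi z)].
Proof.
move=> mpsi ch.
rewrite (_ : [set z | _] =
    \bigcap_j \bigcup_am (psi @^-1` affine_approx iota h j am)); last first.
  apply/seteqP; split=> z /= dz j.
    by move=> _; have [am ?] := dz j; exists am.
  by have [am _ ?] := dz j Logic.I; exists am.
apply: bigcapT_measurable => j.
apply: countable_bigcupT_measurable; first exact: countableP.
move=> am; rewrite -(setCK (psi @^-1` _)); apply: measurableC.
exact/(mpsi (~` affine_approx _ _ _ _))/closed_openC/closed_affine_approx.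
Qed.

(** Differentiability in the last [k] coordinates holds, for each value of the
    first one, almost everywhere; by Fubini it holds on almost every line at
    almost every point, and the density argument upgrades it there to
    differentiability in all coordinates. *)
Lemma rademacher_lines k d (T : measurableType d)
    (nu : {sigma_finite_measure set T -> \bar R}) (phi : T -> 'cV[R]_k)
    (h : 'cV[R]_(1 + k) -> R) K :
  ae_differentiates nu phi ->
  0 <= K -> (forall x y, `|h x - h y| <= K * `|x - y|) ->
  {ae nu, forall s, {ae leb, forall t, eps_diff id h (pt t (phi s))}}.
Proof.
move=> [mphi _ aephi] K0 hK.
pose N : set (T * measurableTypeR R) :=
  ~` [set z | eps_diff (pt 0) h (pt z.2 (phi z.1))].
have mN : measurable N.
  apply/measurableC/measurable_eps_diff; last exact: lipschitz_continuous hK.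
  by move=> O oO; exact: (measurable_pt_preimage mphi oO).
have N0 t : nu (ysection N t) = 0%E.
  apply: measure_negligible; first exact: measurable_ysection.
  have htK u v : `|h (pt t u) - h (pt t v)| <= K * `|u - v|.
    rewrite (le_trans (hK _ _))// ler_wpM2l// ptB subrr.
    by rewrite norm_pt_le// normr0.
  apply: negligibleS (aephi (fun u => h (pt t u)) _ K0 htK) => s.
  by rewrite ysectionE/= => nE /eps_diff_pt.
have := null_ysection_xsection leb mN N0.
apply: filterS => s s0; apply: (ae_eps_diff_line K0 hK).
exists (xsection N s); split => //; first exact: measurable_xsection.
by move=> t nd; rewrite xsectionE.
Qed.

(** Rademacher's theorem, by induction on the dimension. *)
Lemma rademacher k : exists d (T : measurableType d)
    (nu : {sigma_finite_measure set T -> \bar R}) (phi : T -> 'cV[R]_k),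
  ae_differentiates nu phi.
Proof.
elim: k => [|k [d [T [nu [phi aphi]]]]].
  (* any nonzero measure would do in dimension zero *)
  exists _, (measurableTypeR R), (@lebesgue_measure R), (fun=> 0); split.
  - move=> O _; have [in0|out0] := pselect (O 0).
      by rewrite (_ : _ @^-1` _ = setT) //; apply/seteqP; split.
    by rewrite (_ : _ @^-1` _ = set0) //; apply/seteqP; split.
  - move=> y e e0; rewrite (_ : _ @^-1` _ = setT).
      by rewrite [X in X != _](_ : _ = leb setT)// -set_itvNyy lebesgue_measure_itv.
    apply/seteqP; split => // t _ /=; rewrite (_ : y = 0); first exact: ballxx.
    by apply/matrixP => -[].
  - move=> h K K0 hK; apply: aeW => t /= j; exists (0, 0%N) => u _.
    rewrite (_ : u = 0); last by apply/matrixP => -[].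
    by rewrite addr0 subrr sub0r /dotp big_ord0 oppr0 !normr0 mulr0.
have [mphi pphi dphi] := aphi.
have [m mE] := product_sigma_finite nu leb.
exists _, (T * measurableTypeR R)%type, m, (fun z => pt z.2 (phi z.1)).
rewrite /ae_differentiates mE; split.
- by move=> O oO; exact: (measurable_pt_preimage mphi oO).
- move=> y e e0; apply/negP => /eqP y0; pose y1 := (y : 'cV_(1 + k)) 0 0.
  have : ((nu \x leb) ((phi @^-1` ball (dsubmx (y : 'cV_(1 + k))) e) `*`
                 (ball y1 e)) = 0)%E.
    apply/eqP; rewrite eq_le measure_ge0 andbT -y0; apply: le_measure; rewrite ?inE.
    + apply: measurableX; first exact: (mphi _ (ball_open _ _)).
      exact: measurable_realfun.measurable_ball.
    + exact: (measurable_pt_preimage mphi (ball_open _ _)).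
    + move=> [s t] /= [sy ty]; move: sy; rewrite -!ball_normE/= => sy.
      have := pt_lipschitz ty sy; rewrite /y1 -(pt_surj (y : 'cV_(1 + k))).
      exact.
  rewrite product_measure1E; last 2 first.
    exact: (mphi _ (ball_open _ _)).
    exact: measurable_realfun.measurable_ball.
  move/eqP; rewrite mule_eq0 (negbTE (pphi _ _ e0))/=.
  by rewrite [leb _]lebesgue_measure_ball ?ltW// eqe mulrn_eq0/= gt_eqF.
- move=> h K K0 hK; set N := [set z | eps_diff id h (pt z.2 (phi z.1))].
  have mN : measurable (~` N : set (T * measurableTypeR R)).
    apply/measurableC/measurable_eps_diff; last exact: lipschitz_continuous hK.
    by move=> O oO; exact: (measurable_pt_preimage mphi oO).
  exists (~` N); split => //.
  rewrite /product_measure1 -[RHS](integral0 nu setT).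
  apply: ge0_ae_eq_integral => //; first exact: measurable_fun_xsection.
  apply: filterS (rademacher_lines aphi K0 hK) => s ae_s _ /=.
  apply: measure_negligible; first exact: measurable_xsection.
  by rewrite xsectionE; exact: ae_s.
Qed.

End Rademacher.

(** * Differentials and compactness in spaces of matrices *)

Section MatrixAnalysis.
Context {R : realType}.

Lemma norm_mulmx_le m n q (B : 'M[R]_(m, n)) (C : 'M[R]_(n, q)) :
  `|B *m C| <= n%:R * `|B| * `|C|.
Proof.
apply: normm_le => [|i j]; first by rewrite !mulr_ge0.
rewrite mxE (le_trans (ler_norm_sum _ _ _))//.
apply: (@le_trans _ _ (\sum_(l < n) `|B| * `|C|)).
  by apply: ler_sum => l _; rewrite normrM ler_pM// normm_entry.
by rewrite sumr_const card_ord -[leLHS]mulr_natl mulrA.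
Qed.

Lemma mulmx_continuous m n q (B : 'M[R]_(m, n)) :
  continuous (mulmx B : 'M[R]_(n, q) -> 'M[R]_(m, q)).
Proof.
apply: (@lipschitz_continuous _ _ _ _ (n%:R * `|B|)) => u v.
by rewrite -mulmxBr norm_mulmx_le.
Qed.

Lemma norm_mxvec m n (M : 'M[R]_(m, n)) : `|mxvec M| <= `|M|.
Proof.
apply: normm_le => // i j; rewrite ord1.
by case/mxvec_indexP: j => i' j'; rewrite mxvecE normm_entry.
Qed.

Lemma norm_vec_mx m n (v : 'rV[R]_(m * n)) : `|vec_mx v| <= `|v|.
Proof. by apply: normm_le => // i j; rewrite mxE normm_entry. Qed.

(** Bolzano-Weierstrass. Asking for [k <= s k] rather than for the monotonicity
    of [s] leaves one independent choice for each [k]. *)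
Lemma bounded_subseq m n (u : nat -> 'M[R]_(m, n)) M : (forall k, `|u k| <= M) ->
  exists (H : 'M[R]_(m, n)) (s : nat -> nat), (forall k, (k <= s k)%N) /\
    (fun k => u (s k)) @ \oo --> H.
Proof.
move=> uM; pose A : set 'rV[R]_(m * n) := [set v | `|v| <= M].
have cA : compact A.
  apply: bounded_closed_compact.
    by exists M; split; [exact: num_real|move=> x Mx v /= /le_trans; apply; exact: ltW].
  apply: (@preimage_closed _ _ (fun v : 'rV[R]_(m * n) => `|v|) [set y | y <= M]).
    by move=> v _; exact: norm_continuous.
  exact: closed_le.
have [|v [_ clv]] := cA ((mxvec \o u) @ \oo) _.
  by exists 0%N => // k _; rewrite /A/= (le_trans (norm_mxvec _)).
have near k : exists l, (k <= l)%N /\ `|v - mxvec (u l)| < k.+1%:R^-1.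
  have [||_ [[l kl <-] vl]] :=
      clv [set mxvec (u l) | l in [set l | (k <= l)%N]] (ball v k.+1%:R^-1).
  - by exists k => // l kl; exists l.
  - by apply: nbhsx_ballx; rewrite invr_gt0.
  - by exists l; split => //; move: vl; rewrite -ball_normE.
exists (vec_mx v), (fun k => sval (cid (near k))); split.
  by move=> k; case: cid => l [].
apply/cvgrPdist_lt => e e0; near=> k.
rewrite /=; case: cid => l [_ /= vl].
rewrite -[u l]mxvecK -linearB (le_lt_trans (norm_vec_mx _))// (lt_trans vl)//.
by near: k; exact: near_infty_natSinv_lt (PosNum e0).
Unshelve. all: by end_near. Qed.

Lemma differentiable_eps (V W : normedModType R) (f : V -> W)
    (df : {linear V -> W}) x : continuous df ->
  (forall e, 0 < e -> exists2 dl, 0 < dl & forall u, `|u| < dl ->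
    `|f (x + u) - f x - df u| <= e * `|u|) ->
  differentiable f x /\ 'd f x = df :> (V -> W).
Proof.
move=> cdf hdf.
have dxf : f \o shift x = cst (f x) + df +o_ 0 id.
  apply/eqaddoP => e e0; have [dl dl0 h] := hdf e e0.
  apply/nbhs_ballP; exists dl => // u; rewrite -ball_normE/= sub0r normrN.
  by move=> /h; rewrite !fctE/= (addrC u) opprD addrA.
have dE := diff_unique cdf dxf; split => //.
by apply/diff_locallyP; rewrite dE.
Qed.

Lemma differentiable_eps_def (V W : normedModType R) (f : V -> W) x :
  differentiable f x -> forall e, 0 < e -> exists2 dl, 0 < dl &
    forall u, `|u| < dl -> `|f (x + u) - f x - 'd f x u| <= e * `|u|.
Proof.
move=> /diff_locallyP[_ /eqaddoP h] e e0.
have /nbhs_ballP[dl dl0 hd] := h e e0; exists dl => // u udl.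
have := hd u; rewrite -ball_normE/= sub0r normrN => /(_ udl).
by rewrite !fctE/= (addrC u) opprD addrA.
Qed.

Lemma is_derive_eps (V W : normedModType R) (f : V -> W) (x v : V) (c : W) :
  (forall e, 0 < e -> exists2 dl, 0 < dl & forall s, `|s| < dl ->
    `|f (x + s *: v) - f x - s *: c| <= e * `|s|) -> is_derive x v f c.
Proof.
move=> hf.
have c_cvg : h^-1 *: ((f \o shift x) (h *: v) - f x) @[h --> (0 : R)^'] --> c.
  apply/cvgrPdist_le => e e0; have [dl dl0 h] := hf e e0.
  near=> s; have sdl : `|s| < dl by near: s; exact: dnbhs0_lt.
  have s0 : s != 0 by near: s; exact: nbhs_dnbhs_neq.
  have ns0 : 0 < `|s| by rewrite normr_gt0.
  rewrite /shift/= -[X in X - _](scalerK s0) -scalerBr normrZ normfV.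
  by rewrite ler_pdivrMl// mulrC distrC (addrC (s *: v)); exact: h.
by split; [apply/cvg_ex; exists c|exact/cvg_lim].
Unshelve. all: by end_near. Qed.

(** The rational slopes, one for each tolerance, are bounded by the Lipschitz
    constant; any of their limit points is the gradient. *)
Lemma eps_diff_gradient n (h : 'cV[R]_n -> R) K x :
  0 <= K -> (forall y z, `|h y - h z| <= K * `|y - z|) -> eps_diff id h x ->
  exists a : 'cV[R]_n, forall e, 0 < e -> exists2 dl, 0 < dl &
    forall u, `|u| < dl -> `|h (x + u) - h x - dotp a u| <= e * `|u|.
Proof.
move=> K0 hK dh; pose am j := sval (cid (dh j)).
have hq j u : `|u| <= (am j).2.+1%:R^-1 ->
    `|h (x + u) - h x - dotp (map_mx ratr (am j).1) u| <= j.+1%:R^-1 * `|u|.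
  by rewrite /am; case: cid => c /= hc; exact: hc.
pose a j : 'cV[R]_n := map_mx ratr (am j).1.
have aK j : `|a j| <= K + 1.
  apply: normm_le => [|i l]; first by rewrite addr_ge0.
  pose tau : R := (am j).2.+1%:R^-1; have tau0 : 0 < tau by rewrite invr_gt0.
  pose u : 'cV[R]_n := tau *: delta_mx i 0.
  have utau : `|u| <= tau.
    rewrite normrZ gtr0_norm// ler_piMr ?(ltW tau0)//; apply: normm_le => // i' j'.
    by rewrite mxE; case: (_ && _); rewrite ?normr1 ?normr0.
  have := hq j u utau; have := hK (x + u) x; rewrite [x + u - x]addrAC subrr add0r.
  have -> : dotp (map_mx ratr (am j).1) u = tau * a j i l.
    rewrite dotpZr /dotp (bigD1 i)//= big1 ?addr0 => [|i' ii'].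
      by rewrite !mxE !eqxx mulr1 ord1.
    by rewrite !mxE (negbTE ii') mulr0.
  move=> h1 h2.
  have h3 : `|tau * a j i l| <= K * `|u| + j.+1%:R^-1 * `|u|.
    rewrite (_ : tau * _ = (h (x + u) - h x) - (h (x + u) - h x - tau * a j i l)); last by ring.
    by rewrite (le_trans (ler_normB _ _))// lerD.
  rewrite -(ler_pM2l tau0) -{1}(gtr0_norm tau0) -normrM (le_trans h3)//.
  rewrite -mulrDl mulrC ler_pM ?addr_ge0//.
  by rewrite lerD2l invf_le1// ler1n.
have [c [s [sk sc]]] := bounded_subseq aK.
exists c => e e0.
have n1 : 0 < n%:R + 1 :> R by rewrite ltr_wpDl.
have [k hk] : exists k, `|c - a (s k)| <= e / 2 / (n%:R + 1) /\ (s k).+1%:R^-1 <= e / 2.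
  near \oo => k; exists k; split.
    apply: ltW; near: k; apply: cvgr_dist_lt => //; by rewrite !divr_gt0.
  apply: (@le_trans _ _ k.+1%:R^-1).
    by rewrite lef_pV2 ?posrE// ler_nat ltnS.
  by apply: ltW; near: k; apply: (near_infty_natSinv_lt (PosNum (divr_gt0 e0 _))).
case: hk => ck ke.
exists (am (s k)).2.+1%:R^-1; first by rewrite invr_gt0.
move=> u /ltW/(hq (s k)) hu.
rewrite (_ : _ - dotp c u =
    (h (x + u) - h x - dotp (a (s k)) u) - dotp (c - a (s k)) u); last first.
  by rewrite dotpDl dotpNl; ring.
rewrite (le_trans (ler_normB _ _))// (splitr e) mulrDl lerD//.
  by rewrite (le_trans hu)// ler_wpM2r.
rewrite (le_trans (dotp_norm_le _ _))// ler_wpM2r//.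
apply: (@le_trans _ _ ((n%:R + 1) * `|c - a (s k)|)); first by rewrite ler_wpM2r// lerDl.
by rewrite mulrC -ler_pdivlMr.
Unshelve. all: by end_near. Qed.

Lemma eps_diff_differentiable n q (F : 'cV[R]_n -> 'cV[R]_q) K x :
  0 <= K -> (forall y z, `|F y - F z| <= K * `|y - z|) ->
  (forall i, eps_diff id (fun y => F y i 0) x) -> differentiable F x.
Proof.
move=> K0 FK dF.
have FiK i y z : `|F y i 0 - F z i 0| <= K * `|y - z|.
  rewrite (le_trans _ (FK _ _))//; have := normm_entry (F y - F z) i 0.
  by rewrite !mxE.
have [a ha] : {a : 'I_q -> 'cV[R]_n & forall i e, 0 < e ->
    exists2 dl, 0 < dl & forall u, `|u| < dl ->
    `|F (x + u) i 0 - F x i 0 - dotp (a i) u| <= e * `|u|}.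
  have ex i := cid (eps_diff_gradient K0 (FiK i) (dF i)).
  by exists (fun i => sval (ex i)) => i; case: (ex i).
pose B : 'M[R]_(q, n) := \matrix_(i, j) a i j 0.
suff [] : differentiable F x /\ 'd F x = mulmx B :> ('cV[R]_n -> 'cV[R]_q) by [].
apply: differentiable_eps; first exact: mulmx_continuous.
move=> e e0; pose dl i := s2val (cid2 (ha i e e0)).
exists (\big[Num.min/1]_i dl i).
  by apply/bigmin_gtP; split => // i _; rewrite /dl; case: cid2.
move=> u /bigmin_gtP[_ udl]; apply: normm_le => [|i j].
  by rewrite mulr_ge0// ltW.
rewrite ord1 !mxE (_ : \sum_j _ = dotp (a i) u); last first.
  by apply: eq_bigr => l _; rewrite mxE.
by have := udl i isT; rewrite /dl; case: cid2 => d /= d0; apply.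
Qed.

End MatrixAnalysis.

(** * Hessians near a point *)

Section HessianBound.
Context {R : realType}.

Lemma dotp_ge0 n (u : 'cV[R]_n) : 0 <= dotp u u.
Proof. by apply: sumr_ge0 => i _; rewrite -expr2 sqr_ge0. Qed.

Lemma dotp_eq0 n (u : 'cV[R]_n) : dotp u u = 0 -> u = 0.
Proof.
move=> d0; apply/matrixP => i j; rewrite ord1 [RHS]mxE; apply/eqP.
rewrite -sqrf_eq0 expr2; apply/eqP; apply: (psumr_eq0P _ d0) => // k _.
by rewrite -expr2 sqr_ge0.
Qed.

Lemma cvg_sum_fin (T : Type) (F : set_system T) (I : finType) (f : I -> T -> R)
    (l : I -> R) : Filter F -> (forall i, f i x @[x --> F] --> l i) ->
  \sum_i f i x @[x --> F] --> \sum_i l i.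
Proof.
move=> FF fl; rewrite (_ : (fun x => _) = \sum_i f i); last first.
  by apply/funext => x; rewrite fct_sumE.
elim/big_ind2: _ => [|g a h b ga hb|i _]; last exact: fl.
  exact: cvg_cst.
exact: cvgD.
Qed.

Definition jacobian_mx n q (F : 'cV[R]_n -> 'cV[R]_q) (z : 'cV[R]_n) : 'M[R]_(q, n) :=
  \matrix_(i, j) ('d F z (delta_mx j 0)) i 0.

Lemma jacobian_mxE n q (F : 'cV[R]_n -> 'cV[R]_q) z v :
  jacobian_mx F z *m v = 'd F z v.
Proof.
have {2}-> : v = \sum_j v j 0 *: delta_mx j 0.
  by rewrite {1}[v]matrix_sum_delta; apply: eq_bigr => i _; rewrite big_ord1.
rewrite linear_sum; apply/matrixP => i j; rewrite ord1 !mxE summxE.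
by apply: eq_bigr => l _; rewrite linearZ !mxE mulrC.
Qed.

Lemma norm_diff_le n q (F : 'cV[R]_n -> 'cV[R]_q) x0 r K z :
  (forall x y, ball x0 r x -> ball x0 r y -> `|F x - F y| <= K * `|x - y|) ->
  ball x0 r z -> differentiable F z -> forall v, `|'d F z v| <= (K + 1) * `|v|.
Proof.
move=> FK xz dF v; have [->|v0] := eqVneq v 0.
  by rewrite linear0 !normr0 mulr0.
have nv0 : 0 < `|v| by rewrite normr_gt0.
have [dl dl0 hdl] := differentiable_eps_def dF ltr01.
have /nbhs_ballP[d d0 hd] : nbhs z (ball x0 r).
  by apply: (@open_nbhs_nbhs _ z); split => //; exact: ball_open.
pose tau := Num.min dl d / 2 / `|v|.
have md0 : 0 < Num.min dl d by rewrite lt_min dl0.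
have tau0 : 0 < tau by rewrite !divr_gt0.
have tauv : `|tau *: v| < Num.min dl d.
  rewrite normrZ (gtr0_norm tau0) /tau mulfVK ?gt_eqF//.
  by rewrite ltr_pdivrMr// ltr_pMr// ltr1n.
move: tauv; rewrite lt_min => /andP[/hdl h1 h2].
have h3 := FK (z + tau *: v) z (hd _ _) xz.
have {}h3 : `|F (z + tau *: v) - F z| <= K * `|tau *: v|.
  have := h3; rewrite [z + _ - z]addrAC subrr add0r; apply.
  by rewrite -ball_normE/= opprD addrA subrr sub0r normrN.
have : `|'d F z (tau *: v)| <= (K + 1) * `|tau *: v|.
  rewrite (_ : 'd F z _ = (F (z + tau *: v) - F z) -
    (F (z + tau *: v) - F z - 'd F z (tau *: v))); last by rewrite opprB addrC subrK.
  by rewrite (le_trans (ler_normB _ _))// mulrDl lerD.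
by rewrite linearZ/= !(normrZ tau) (gtr0_norm tau0) mulrCA ler_pM2l.
Qed.

(** By compactness: otherwise Hessians at points tending to [x0], together with
    unit vectors on which they fail to be uniformly positive, would accumulate at
    an element of the generalized Hessian that is not positive definite. *)
Lemma hessian_lower_bound n (f : 'cV[R]_n -> R) x0 r K : 0 < r ->
  (forall x y, ball x0 r x -> ball x0 r y ->
    `|grad f x - grad f y| <= K * `|x - y|) ->
  (forall H, generalized_hessian f x0 H -> posdefmx H) ->
  exists m rho, [/\ 0 < m, 0 < rho <= r & forall z, ball x0 rho z ->
    differentiable (grad f) z -> forall v, m * dotp v v <= dotp v ('d (grad f) z v)].
Proof.
move=> r0 FK pd; apply: contrapT => nb.
have bad k : exists zv : 'cV[R]_n * 'cV[R]_n,
    [/\ `|x0 - zv.1| < k.+1%:R^-1, ball x0 r zv.1, differentiable (grad f) zv.1,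
        `|zv.2| = 1 & dotp zv.2 (hessian f zv.1 *m zv.2) <= n%:R / k.+1%:R].
  apply: contrapT => nk; apply: nb; exists k.+1%:R^-1, (Num.min r k.+1%:R^-1).
  split; rewrite ?lt_min ?r0 ?invr_gt0 ?ge_min ?lexx ?ltr0n//.
  move=> z xz dz v; rewrite leNgt; apply/negP => lt; apply: nk.
  have v0 : v != 0.
    by apply/eqP => v0; move: lt; rewrite v0 /dotp !big1 ?mulr0 ?ltxx// => i _; rewrite mxE mul0r.
  have nv0 : 0 < `|v| by rewrite normr_gt0.
  have xzr : ball x0 r z by apply: le_ball xz; rewrite ge_min lexx.
  have xzk : `|x0 - z| < k.+1%:R^-1.
    by move: xz; rewrite -ball_normE/= lt_min => /andP[].
  exists (z, `|v|^-1 *: v); split.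
  - exact: xzk.
  - exact: xzr.
  - exact: dz.
  - by rewrite normrZ normfV normr_id mulVf// gt_eqF.
  - rewrite (jacobian_mxE (grad f)) linearZ/= dotpZl dotpZr mulrA.
    rewrite -invfM -expr2 [leLHS]mulrC ler_pdivrMr ?exprn_gt0//.
    have nv : dotp v v <= n%:R * `|v| ^+ 2.
      by rewrite (le_trans (ler_norm _))// (le_trans (dotp_norm_le _ _))// expr2 mulrA.
    have : dotp v ('d (grad f) z v) <= k.+1%:R^-1 * (n%:R * `|v| ^+ 2).
      by rewrite (le_trans (ltW lt))// ler_wpM2l.
    by move=> /le_trans; apply; rewrite mulrCA mulrA.
(* the Hessian and the vector are packed in one matrix to extract only once *)
have bd k : `|row_mx (hessian f (sval (cid (bad k))).1) (sval (cid (bad k))).2| <= `|K + 1| + 1.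
  case: cid => -[z v] /= [_ xz dz v1 _]; apply: normm_le => [|i j]; first exact: addr_ge0.
  rewrite mxE; case: splitP => l _; last by rewrite (le_trans (normm_entry _ _ _))// v1 lerDr.
  rewrite mxE (le_trans (normm_entry _ _ _))// (le_trans (norm_diff_le FK xz dz _))//.
  rewrite (@le_trans _ _ `|K + 1|) ?lerDl// (le_trans (ler_norm _))// normrM normr_id.
  rewrite ler_piMr//; apply: normm_le => // i' j'.
  by rewrite mxE; case: (_ && _); rewrite ?normr1 ?normr0.
have [L [s [sk sL]]] := bounded_subseq bd.
pose z k := (sval (cid (bad (s k)))).1; pose w k := (sval (cid (bad (s k)))).2.
have P k : [/\ `|x0 - z k| < (s k).+1%:R^-1, ball x0 r (z k), differentiable (grad f) (z k),
    `|w k| = 1 & dotp (w k) (hessian f (z k) *m (w k)) <= n%:R / (s k).+1%:R].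
  by rewrite /z /w; case: cid.
have ks k : (s k).+1%:R^-1 <= k.+1%:R^-1 :> R by rewrite lef_pV2 ?posrE// ler_nat ltnS.
have HL : (fun k => hessian f (z k)) @ \oo --> lsubmx L.
  have := cvg_comp _ _ sL (@continuous_lsubmx _ _ _ _ L).
  by apply: cvg_trans; apply: near_eq_cvg; apply: nearW => k /=; rewrite row_mxKl.
have wL : w @ \oo --> rsubmx L.
  have := cvg_comp _ _ sL (@continuous_rsubmx _ _ _ _ L).
  by apply: cvg_trans; apply: near_eq_cvg; apply: nearW => k /=; rewrite row_mxKr.
have gH : generalized_hessian f x0 (lsubmx L).
  move=> C [_ CS]; apply: CS; exists z; split => //; last by move=> k; case: (P k).
  apply/cvgrPdist_lt => e e0; near=> k.
  have [lt _ _ _ _] := P k; rewrite (lt_trans lt)// (le_lt_trans (ks k))//.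
  by near: k; exact: (near_infty_natSinv_lt (PosNum e0)).
have w1 : `|rsubmx L| = 1.
  have c1 : `|w k| @[k --> \oo] --> (1 : R).
    rewrite (_ : (fun k => `|w k|) = cst 1); first exact: cvg_cst.
    by apply/funext => k; case: (P k).
  exact: (cvg_unique (@Rhausdorff R) (cvg_norm wL) c1).
have : 0 < dotp (rsubmx L) (lsubmx L *m rsubmx L).
  by apply: pd gH _ _; rewrite -normr_gt0 w1.
apply/negP; rewrite -leNgt.
have c1 : dotp (w k) (hessian f (z k) *m w k) @[k --> \oo] -->
    dotp (rsubmx L) (lsubmx L *m rsubmx L).
  apply: cvg_sum_fin => i; apply: cvgM.
    exact: (cvg_comp _ _ wL (@coord_continuous _ _ _ i 0 (rsubmx L))).
  rewrite mxE; under eq_fun do rewrite mxE.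
  apply: cvg_sum_fin => j; apply: cvgM.
    exact: (cvg_comp _ _ HL (@coord_continuous _ _ _ i j (lsubmx L))).
  exact: (cvg_comp _ _ wL (@coord_continuous _ _ _ j 0 (rsubmx L))).
have c2 : n%:R / k.+1%:R @[k --> \oo] --> (0 : R).
  rewrite -[X in _ --> X](mulr0 n%:R); apply: cvgMr => //.
  exact: cvg_harmonic.
apply: (ler_cvg_to c1 c2); apply: nearW => k.
have [_ _ _ _ le] := P k; rewrite (le_trans le)// ler_wpM2l//.
Unshelve. all: by end_near. Qed.

End HessianBound.

(** * Strong monotonicity on balls *)

Section StrongMonotonicity.
Context {R : realType}.

(** The projection on the cube of centre [x0] and radius [r], used to extend a
    map that is Lipschitz on the cube to a map that is Lipschitz everywhere. *)
Definition clamp n (x0 : 'cV[R]_n) (r : R) (z : 'cV[R]_n) : 'cV[R]_n :=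
  \col_i Num.max (x0 i 0 - r) (Num.min (x0 i 0 + r) (z i 0)).

Lemma clamp_id n (x0 : 'cV[R]_n) r z : `|x0 - z| <= r -> clamp x0 r z = z.
Proof.
move=> xz; apply/matrixP => i j; rewrite ord1 mxE.
have := le_trans (normm_entry (x0 - z) i 0) xz; rewrite !mxE ler_norml => /andP[h1 h2].
by rewrite min_r ?max_r//; lra.
Qed.

Lemma clamp_in n (x0 : 'cV[R]_n) r z : 0 <= r -> `|x0 - clamp x0 r z| <= r.
Proof.
move=> r0; apply: normm_le => // i j; rewrite ord1 !mxE ler_norml.
by have [] := leP (x0 i 0 + r) (z i 0); have [] := leP (x0 i 0 - r) (z i 0);
  have [] := leP (x0 i 0 - r) (x0 i 0 + r); move=> *; apply/andP; split; lra.
Qed.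

Lemma clamp_lipschitz n (x0 : 'cV[R]_n) r y z : 0 <= r ->
  `|clamp x0 r y - clamp x0 r z| <= `|y - z|.
Proof.
move=> r0; apply: normm_le => // i j; rewrite ord1 !mxE.
have := normm_entry (y - z) i 0; rewrite !mxE; apply: le_trans.
set a := x0 i 0 - r; set b := x0 i 0 + r; set p := y i 0; set q := z i 0.
have ab : a <= b by rewrite /a /b; lra.
clearbody a b p q; clear -ab; rewrite !maxEle !minEle.
by case: (leP b p) => ?; case: (leP b q) => ?; case: (leP a b) => ?;
  case: (leP a p) => ?; case: (leP a q) => ?;
  rewrite ler_norml; case: (ger0P (p - q)) => ?; apply/andP; split; lra.
Qed.

(** Coordinates in which the direction [v] is the first axis. *)
Lemma extend_column k (v : 'cV[R]_k.+1) : v != 0 ->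
  exists2 M : 'M[R]_k.+1, M \in unitmx & M *m delta_mx 0 0 = v.
Proof.
move=> v0; have rv : \rank v = 1%N.
  by apply/eqP; rewrite eqn_leq rank_leq_col lt0n mxrank_eq0.
pose c := row_ebase v 0 0.
have cu : c \is a GRing.unit.
  have := row_ebase_unit v; rewrite [row_ebase v]mx11_scalar unitmxE det_scalar1.
  by [].
exists (c *: col_ebase v); first by rewrite unitmxZ// col_ebase_unit.
rewrite -[RHS]mulmx_ebase rv [row_ebase v]mx11_scalar -/c mul_mx_scalar -scalemxAl.
congr (_ *: (_ *m _)); apply/matrixP => i j.
by rewrite !mxE ord1 eqxx andbT; case: i => -[|i] hi.
Qed.


Lemma ae_exists d (T : measurableType d) (nu : {measure set T -> \bar R})
    (A : set T) (P : T -> Prop) :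
  measurable A -> nu A != 0%E -> {ae nu, forall s, P s} -> exists2 s, A s & P s.
Proof.
move=> mA A0 aeP; apply: contrapT => nP; move/negP: A0; apply; apply/eqP.
apply: measure_negligible => //; apply: negligibleS aeP => s As Ps.
by apply: nP; exists s.
Qed.

Lemma ptE k (t s : R) (u : 'cV[R]_k) :
  pt (t + s) u = pt t u + s *: (delta_mx 0 0 : 'cV[R]_(1 + k)).
Proof.
rewrite -[X in _ = X + _]addr0 -[u in LHS]addr0 -ptD.
have -> : s *: (delta_mx 0 0 : 'cV[R]_(1 + k)) = pt s 0.
  apply/matrixP => i j; rewrite ord1 /pt !mxE; case: splitP => l li; rewrite mxE.
    rewrite (ord1 l) (_ : i == 0); last by apply/eqP/val_inj; rewrite /= li (ord1 l).
    by rewrite mulr1 mulr1n.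
  rewrite (_ : (i == 0) = false) ?mulr0//.
  by apply/negP => /eqP i0; move: li; rewrite i0.
by rewrite addr0.
Qed.

(** A bound on the derivatives at the points of differentiability only is
    integrated along segments. The segment from [x] to [y] may miss all of these
    points, but by [rademacher_lines], in coordinates whose first axis is [y - x],
    there are arbitrarily close parallel segments almost all of whose points are
    of this kind; continuity concludes. *)
Lemma strong_monotone_ball n (F : 'cV[R]_n -> 'cV[R]_n) x0 r K m :
  0 <= K ->
  (forall x y, ball x0 r x -> ball x0 r y -> `|F x - F y| <= K * `|x - y|) ->
  (forall z, ball x0 r z -> differentiable F z ->
    forall v, m * dotp v v <= dotp v ('d F z v)) ->
  forall x y, ball x0 r x -> ball x0 r y ->
    m * dotp (y - x) (y - x) <= dotp (y - x) (F y - F x).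
Proof.
case: n F x0 => [|k] F x0 K0 FK Fm x y; first by rewrite /dotp !big_ord0 mulr0.
rewrite -!ball_normE /= => xr yr; set v := y - x.
have [->|v0] := eqVneq v 0.
  by rewrite /dotp !big1 ?mulr0// => i _; rewrite mxE mul0r.
have [M Mu Mv] := extend_column v0.
pose r1 := Num.max `|x0 - x| `|x0 - y|.
have r1r : r1 < r by rewrite gt_max xr.
have r10 : 0 <= r1 by rewrite le_max normr_ge0.
(* the segment lies in the cube of radius r1; nearby parallel segments stay in
   the interior of the cube of radius r2, where clamping changes nothing *)
pose r2 := (r1 + r) / 2.
have r12 : r1 < r2 by rewrite /r2; lra.
have r2r : r2 < r by rewrite /r2; lra.
have r20 : 0 <= r2 by lra.
pose Fc z := F (clamp x0 r2 z).
have FcE z : `|x0 - z| <= r2 -> Fc z = F z by move=> h; rewrite /Fc clamp_id.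
have FcK y1 y2 : `|Fc y1 - Fc y2| <= K * `|y1 - y2|.
  have inb w : ball x0 r (clamp x0 r2 w).
    by rewrite -ball_normE/=; exact: le_lt_trans (clamp_in _ _ r20) r2r.
  by rewrite (le_trans (FK _ _ (inb _) (inb _)))// ler_wpM2l// clamp_lipschitz.
pose G (w : 'cV[R]_(1 + k)) := Fc (x + M *m w).
pose CM := k.+1%:R * `|M|.
have CM0 : 0 <= CM by rewrite mulr_ge0.
have GK w1 w2 : `|G w1 - G w2| <= K * CM * `|w1 - w2|.
  rewrite (le_trans (FcK _ _))// -mulrA ler_wpM2l//.
  by rewrite opprD addrACA subrr add0r -mulmxBr norm_mulmx_le.
have KCM0 : 0 <= K * CM by rewrite mulr_ge0.
have GiK i w1 w2 : `|G w1 i 0 - G w2 i 0| <= K * CM * `|w1 - w2|.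
  by rewrite (le_trans _ (GK _ _))//; have := normm_entry (G w1 - G w2) i 0; rewrite !mxE.
have line (u0 : 'cV[R]_k) : CM * `|pt 0 u0| < r2 - r1 ->
    (forall i, {ae @lebesgue_measure R, forall t,
      eps_diff id (fun w => G w i 0) (pt t u0)}) ->
    m * dotp v v <= dotp v (G (pt 1 u0)) - dotp v (G (pt 0 u0)).
  move=> u0s aei; rewrite -[leLHS]mulr1 -[X in _ * X]subr0.
  pose g t := dotp v (G (pt t u0)).
  apply: (@lipschitz_ae_derive_ge _ g (k.+1%:R * `|v| * (K * CM))) => //.
    move=> t s; rewrite /g -dotpNr -dotpDr (le_trans (dotp_norm_le _ _))//.
    rewrite -[leRHS]mulrA ler_wpM2l ?mulr_ge0// (le_trans (GK _ _))// ler_wpM2l//.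
    by rewrite ptB subrr norm_pt_le// normr0.
  have := ae_forall_countable aei; apply: filterS.
  move=> t dGi /andP[t0 t1] _.
  have dG : differentiable G (pt t u0) by exact: (eps_diff_differentiable KCM0 GK).
  pose J := jacobian_mx G (pt t u0); pose z := x + M *m pt t u0.
  have zr2 : `|x0 - z| < r2.
    have -> : x0 - z = (1 - t) *: (x0 - x) + t *: (x0 - y) - M *m pt 0 u0.
      rewrite /z -[t in pt t u0]add0r ptE mulmxDr -scalemxAr Mv /v.
      by apply/matrixP => i j; rewrite !mxE; ring.
    rewrite (le_lt_trans (ler_normB _ _))//.
    have h1 := le_lt_trans (norm_mulmx_le M (pt 0 u0)) u0s.
    have h2 : `|(1 - t) *: (x0 - x) + t *: (x0 - y)| <= r1.
      rewrite (le_trans (ler_normD _ _))// !normrZ !ger0_norm ?subr_ge0 ?(ltW t0) ?(ltW t1)//.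
      rewrite (_ : r1 = (1 - t) * r1 + t * r1); last by ring.
      by apply: lerD; apply: ler_wpM2l; rewrite ?subr_ge0 ?(ltW t0) ?(ltW t1)// le_max lexx ?orbT.
    lra.
  have JE w : J *m w = 'd G (pt t u0) w by exact: jacobian_mxE.
  pose C := k.+1%:R * `|invmx M| + 1.
  have C0 : 0 < C by rewrite ltr_wpDl// mulr_ge0.
  have Cle (u : 'cV[R]_k.+1) : `|invmx M *m u| <= C * `|u|.
    by rewrite (le_trans (norm_mulmx_le _ _))// ler_wpM2r// lerDl.
  have [dF dFE] : differentiable F z /\
      'd F z = mulmx (J *m invmx M) :> ('cV[R]_k.+1 -> 'cV[R]_k.+1).
    apply: differentiable_eps; first exact: mulmx_continuous.
    move=> e e0; have [dl dl0 hdl] := differentiable_eps_def dG (divr_gt0 e0 C0).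
    exists (Num.min (dl / C) (r2 - `|x0 - z|)).
      by rewrite lt_min divr_gt0// subr_gt0.
    move=> u; rewrite lt_min => /andP[u1 u2].
    have /hdl : `|invmx M *m u| < dl.
      by rewrite (le_lt_trans (Cle u))// mulrC -ltr_pdivlMr.
    rewrite /G mulmxDr mulKVmx// addrA -/z -JE mulmxA.
    rewrite FcE; last first.
      by rewrite opprD addrA (le_trans (ler_normB _ _))//; lra.
    rewrite FcE ?(ltW zr2)// => /le_trans; apply.
    by rewrite -mulrA ler_wpM2l ?(ltW e0)// ler_pdivrMl.
  have dg : is_derive t (1 : R) g (dotp v ('d F z v)).
    have -> : 'd F z v = J *m delta_mx 0 0.
      by rewrite dFE -[in LHS]Mv -mulmxA mulKmx.
    apply: is_derive_eps => e e0.
    have C1 : 0 < k.+1%:R * `|v| + 1 by rewrite ltr_wpDl// mulr_ge0.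
    have [dl dl0 hdl] := differentiable_eps_def dG (divr_gt0 e0 C1).
    have n1 s : `|s *: (delta_mx 0 0 : 'cV[R]_(1 + k))| <= `|s|.
      rewrite normrZ ler_piMr//; apply: normm_le => // i' j'.
      by rewrite mxE; case: (_ && _); rewrite ?normr1 ?normr0.
    exists dl => // s sdl; rewrite (_ : s *: (1 : R) = s); last first.
      by rewrite /GRing.scale/= mulr1.
    have := hdl _ (le_lt_trans (n1 s) sdl).
    rewrite -(ptE t s u0) -JE -scalemxAr.
    move=> h; rewrite /g -dotpNr -dotpDr /GRing.scale/= -dotpZr -dotpNr -dotpDr.
    rewrite (le_trans (dotp_norm_le _ _))//.
    rewrite (le_trans (ler_wpM2l _ h)) ?mulr_ge0//.
    rewrite mulrA [_ * (e / _)]mulrC -mulrA.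
    have e1 : 0 <= e / (k.+1%:R * `|v| + 1) by rewrite ltW// divr_gt0.
    apply: (@le_trans _ _ (e / (k.+1%:R * `|v| + 1) * ((k.+1%:R * `|v| + 1) * `|s|))).
      by rewrite ler_wpM2l// ler_pM// ?mulr_ge0// lerDl.
    by rewrite mulrA divfK// gt_eqF.
  rewrite [X in _ <= X]derive_val; apply: Fm => //.
  by rewrite -ball_normE/=; exact: lt_trans r2r.
apply/ler_addgt0Pr => e e0.
have [d [T [nu [phi aphi]]]] := @rademacher R k.
have [mphi pphi _] := aphi.
have aeN : {ae nu, forall s, forall i, {ae @lebesgue_measure R, forall t,
    eps_diff id (fun w => G w i 0) (pt t (phi s))}}.
  by apply: ae_forall_countable => i; exact: (rademacher_lines aphi KCM0 (GiK i)).
pose B := k.+1%:R * `|v| * (K * CM) + 1.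
have B0 : 0 < B by rewrite ltr_wpDl// !mulr_ge0.
pose rho := Num.min ((r2 - r1) / (CM + 1)) (e / 2 / B).
have CM1 : 0 < CM + 1 by rewrite ltr_wpDl.
have rho0 : 0 < rho by rewrite lt_min !divr_gt0// subr_gt0.
have [s] := ae_exists (mphi _ (ball_open 0 rho)) (pphi 0 _ rho0) aeN.
rewrite /= -ball_normE/= sub0r normrN => srho sP.
have p0 : `|pt 0 (phi s)| <= `|phi s| by rewrite norm_pt_le// normr0.
have ps1 : `|pt 0 (phi s)| * (CM + 1) < r2 - r1.
  by rewrite -ltr_pdivlMr// (le_lt_trans p0)// (lt_le_trans srho)// ge_min lexx.
have ps2 : `|pt 0 (phi s)| * B <= e / 2.
  by rewrite -ler_pdivlMr// (le_trans p0)// (le_trans (ltW srho))// ge_min lexx orbT.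
have /line/(_ sP) : CM * `|pt 0 (phi s)| < r2 - r1.
  by rewrite (le_lt_trans _ ps1)// mulrC ler_wpM2l// lerDl.
have err t : `|dotp v (G (pt t (phi s))) - dotp v (G (pt t 0))| <= e / 2.
  rewrite -dotpNr -dotpDr (le_trans (dotp_norm_le _ _))//.
  rewrite (le_trans (ler_wpM2l _ (GK _ _))) ?mulr_ge0// ptB subrr subr0 mulrA.
  by rewrite (le_trans _ ps2)// mulrC ler_wpM2l// lerDl.
have pt00 : pt 0 0 = 0 :> 'cV[R]_(1 + k) by rewrite /pt raddf0 col_mx0.
have G0 : G (pt 0 0) = F x.
  by rewrite pt00 /G mulmx0 addr0 FcE// (le_trans _ (ltW r12))// le_max lexx.
have G1 : G (pt 1 0) = F y.
  rewrite -[X in pt X 0]add0r ptE pt00 add0r scale1r /G Mv /v addrC subrK FcE//.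
  by rewrite (le_trans _ (ltW r12))// le_max lexx orbT.
have := err 1; have := err 0; rewrite G0 G1 dotpDr dotpNr !ler_norml.
by move=> /andP[? ?] /andP[? ?] ?; lra.
Qed.

End StrongMonotonicity.

(** * Gradients of convex functions and of the Lagrangian *)

Section Gradients.
Context {R : realType}.

Lemma grad_eps n (f : 'cV[R]_n -> R) (x g : 'cV[R]_n) :
  (forall v, is_derive x v f (dotp g v)) -> grad f x = g.
Proof.
move=> dg; apply/matrixP => i j; rewrite ord1 mxE derive_val /dotp (bigD1 i)//=.
rewrite big1 ?addr0 => [|i' ii']; first by rewrite mxE !eqxx mulr1.
by rewrite mxE (negbTE ii') mulr0.
Qed.

Lemma diff_grad n (f : 'cV[R]_n -> R) (x v : 'cV[R]_n) :
  differentiable f x -> 'd f x v = dotp (grad f x) v.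
Proof.
move=> df; rewrite {1}[v]matrix_sum_delta linear_sum; apply: eq_bigr => i _.
by rewrite big_ord1 linearZ/= mxE deriveE// mulrC.
Qed.

Lemma grad_expansion n (f : 'cV[R]_n -> R) (x v : 'cV[R]_n) :
  differentiable f x -> forall e, 0 < e -> exists2 dl, 0 < dl &
    forall s, `|s| < dl ->
      `|f (x + s *: v) - f x - s * dotp (grad f x) v| <= e * `|s|.
Proof.
move=> df e e0; have v1 : 0 < `|v| + 1 by rewrite ltr_wpDl.
have [dl dl0 h] := differentiable_eps_def df (divr_gt0 e0 v1).
exists (dl / (`|v| + 1)); first exact: divr_gt0.
move=> s sdl; have le1 : `|s *: v| <= `|s| * (`|v| + 1).
  by rewrite normrZ ler_wpM2l// lerDl.
have /h : `|s *: v| < dl by rewrite (le_lt_trans le1)// -ltr_pdivlMr.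
rewrite diff_grad// dotpZr => /le_trans; apply.
rewrite (@le_trans _ _ (e / (`|v| + 1) * (`|s| * (`|v| + 1))))//.
  by rewrite ler_wpM2l// ltW// divr_gt0.
by rewrite mulrCA mulrC divfK// gt_eqF.
Qed.

Lemma convex_le n (f : 'cV[R]_n -> R) (x y : 'cV[R]_n) (t : R) :
  convex_function setT f -> 0 <= t -> t <= 1 ->
  f (x + t *: (y - x)) <= f x + t * (f y - f x).
Proof.
move=> cf t0 t1; have := cf (Itv01 t0 t1) y x; rewrite !inE => /(_ Logic.I Logic.I).
rewrite convRE/= /conv/= /unstable.onem => h.
rewrite (_ : x + _ = t *: y + (1 - t) *: x); last first.
  by rewrite scalerBr scalerBl scale1r addrCA addrA.
by rewrite (le_trans h)// le_eqVlt; apply/orP; left; apply/eqP; ring.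
Qed.

Lemma convex_grad_le n (f : 'cV[R]_n -> R) (x y : 'cV[R]_n) :
  convex_function setT f -> differentiable f x ->
  f x + dotp (grad f x) (y - x) <= f y.
Proof.
move=> cf df; apply/ler_addgt0Pr => e e0.
have [dl dl0 h] := grad_expansion (y - x) df e0.
pose s := Num.min (dl / 2) 1.
have s0 : 0 < s by rewrite lt_min divr_gt0/=.
have sdl : `|s| < dl.
  by rewrite gtr0_norm// (@le_lt_trans _ _ (dl / 2)) ?ge_min ?lexx// ltr_pdivrMr// ltr_pMr// ltr1n.
have s1 : s <= 1 by rewrite ge_min lexx orbT.
have := convex_le x y cf (ltW s0) s1.
have := h s sdl; rewrite ler_norml (gtr0_norm s0) => /andP[h1 _] h2.
rewrite -(ler_pM2l s0); nra.
Qed.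

Lemma convex_grad_monotone n (f : 'cV[R]_n -> R) (x y : 'cV[R]_n) :
  convex_function setT f -> differentiable f x -> differentiable f y ->
  0 <= dotp (x - y) (grad f x - grad f y).
Proof.
move=> cf dx dy; have := convex_grad_le y cf dx; have := convex_grad_le x cf dy.
by rewrite [dotp (x - y) _]dotpC !(dotpDl, dotpDr, dotpNl, dotpNr); lra.
Qed.

(** Stated with a first-order expansion along the line, so as to apply both to
    [f] on the constraint set and to the Lagrangian. *)
Lemma fermat_direction n (f : 'cV[R]_n -> R) (x v : 'cV[R]_n) (c : R) :
  (forall e, 0 < e -> exists2 dl, 0 < dl & forall s, `|s| < dl ->
    `|f (x + s *: v) - f x - s * c| <= e * `|s|) ->
  (forall s : R, f x <= f (x + s *: v)) -> c = 0.
Proof.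
move=> df fx; apply/eqP; rewrite -normr_le0; apply/ler_addgt0Pr => e e0; rewrite add0r.
have [dl dl0 h] := df e e0.
pose s := dl / 2; have s0 : 0 < s by rewrite divr_gt0.
have sdl : `|s| < dl by rewrite gtr0_norm// ltr_pdivrMr// ltr_pMr// ltr1n.
have := h (- s); rewrite normrN => /(_ sdl); have := h s sdl.
have := fx s; have := fx (- s); rewrite !ler_norml (gtr0_norm s0).
move=> f1 f2 /andP[a1 a2] /andP[b1 b2].
by apply/andP; split; rewrite -(ler_pM2l s0); lra.
Qed.

Lemma enorm_sqr n (u : 'cV[R]_n) : enorm u ^+ 2 = dotp u u.
Proof. by rewrite /enorm sqr_sqrtr// dotp_ge0. Qed.

Lemma dotp_mulmx n q (M : 'M[R]_(q, n)) u v : dotp u (M *m v) = dotp (M^T *m u) v.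
Proof.
rewrite /dotp; under eq_bigr do rewrite mxE mulr_sumr.
rewrite exchange_big; apply: eq_bigr => j _/=; rewrite mxE mulr_suml.
by apply: eq_bigr => i _; rewrite mxE; ring.
Qed.

Section Lagrangian.
Context {n p : nat}.
Variables (f : 'cV[R]_n -> R) (A : 'M[R]_(p, n)) (b : 'cV[R]_p) (mu : R).
Local Notation L := (aug_lagrangian f A b mu).

Lemma lagrangian_expansion x l v : mu != 0 -> differentiable f x ->
  forall e, 0 < e -> exists2 dl, 0 < dl & forall s, `|s| < dl ->
    `|L (x + s *: v) l - L x l -
      s * dotp (grad f x + mu^-1 *: (A^T *m (A *m x - b)) + A^T *m l) v| <=
    e * `|s|.
Proof.
move=> mu0 df e e0.
have e2 : 0 < e / 2 by rewrite divr_gt0.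
have [dl dl0 h] := grad_expansion v df e2.
pose q := `|(2 * mu)^-1 * dotp (A *m v) (A *m v)|.
have q1 : 0 < q + 1 by rewrite /q ltr_wpDl.
exists (Num.min dl (e / 2 / (q + 1))); first by rewrite lt_min dl0 divr_gt0.
move=> s; rewrite lt_min => /andP[/h {}h sq].
rewrite /aug_lagrangian !enorm_sqr.
have -> : A *m (x + s *: v) - b = (A *m x - b) + s *: (A *m v).
  by rewrite mulmxDr -scalemxAr addrAC.
set y := A *m x - b; set w := A *m v.
have yw : dotp (A^T *m y) v = dotp y w by rewrite -dotp_mulmx.
have lw : dotp (A^T *m l) v = dotp l w by rewrite -dotp_mulmx.
have qE : q = `|(2 * mu)^-1 * dotp w w| by [].
clearbody y w q.
rewrite !dotpDl !dotpDr !dotpZl !dotpZr yw lw (dotpC w y).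
rewrite (_ : _ - _ = (f (x + s *: v) - f x - s * dotp (grad f x) v) +
  (2 * mu)^-1 * dotp w w * s * s); last by field.
apply: (le_trans (ler_normD _ _)).
rewrite (_ : e * `|s| = e / 2 * `|s| + e / 2 * `|s|); last by field.
apply: lerD => //.
rewrite normrM normrM -qE ler_wpM2r//.
have : `|s| * (q + 1) < e / 2 by rewrite -ltr_pdivlMr.
by move=> /ltW; apply: le_trans; rewrite mulrC ler_wpM2l// lerDl.
Qed.

Lemma grad_lagrangian_x x l : mu != 0 -> differentiable f x ->
  grad (L^~ l) x = grad f x + mu^-1 *: (A^T *m (A *m x - b)) + A^T *m l.
Proof. by move=> mu0 df; apply: grad_eps => v; exact/is_derive_eps/lagrangian_expansion. Qed.

Lemma grad_lagrangian_l x l : grad (L x) l = A *m x - b.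
Proof.
apply: grad_eps => v; apply: is_derive_eps => e e0; exists 1 => // s _.
rewrite /aug_lagrangian /GRing.scale/=; set y := A *m x - b; clearbody y.
rewrite dotpDl dotpZl (dotpC y v).
rewrite [X in `|X|](_ : _ = 0); first by rewrite normr0 mulr_ge0// ltW.
ring.
Qed.

End Lagrangian.

End Gradients.

(** * Gradient bounds on bounded sets, multipliers and saddle points *)

Section GradientBounds.
Context {R : realType} {n : nat}.
Variable f : 'cV[R]_n -> R.
Implicit Types x y : 'cV[R]_n.

Lemma C11_lipschitz x0 : C11 f -> exists r K, [/\ 0 < r, 0 <= K &
  forall x y, ball x0 r x -> ball x0 r y -> `|grad f x - grad f y| <= K * `|x - y|].
Proof.
move=> [_ _ /(_ x0)[U /nbhs_ballP[r r0 rU] [M [_ UM]]]].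
exists r, (`|M| + 1); split=> // x y /rU Ux /rU Uy.
by apply: (UM (`|M| + 1) _ (x, y)) => //; rewrite (le_lt_trans (ler_norm M))// ltrDl.
Qed.

(** Near [x0] this is the Lipschitz property; away from [x0] it suffices that the
    gradient is bounded on bounded sets. *)
Lemma grad_growth x0 rad : C11 f -> exists2 K, 0 <= K &
  forall x, `|x - x0| <= rad -> `|grad f x - grad f x0| <= K * `|x - x0|.
Proof.
move=> c11; have [r [K [r0 K0 FK]]] := C11_lipschitz x0 c11.
have [B hB] : exists B : nat, forall x, `|x - x0| <= rad -> `|grad f x| <= B%:R.
  apply: contrapT => nB.
  have bad (k : nat) : exists x, `|x - x0| <= rad /\ k%:R < `|grad f x|.
    apply: contrapT => nk; apply: nB; exists k => x xr; rewrite leNgt; apply/negP => ?.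
    by apply: nk; exists x.
  have bd k : `|sval (cid (bad k))| <= rad + `|x0|.
    by case: cid => x [/= xr _]; rewrite -[x](subrK x0) (le_trans (ler_normD _ _))// lerD2r.
  have [H [s [sk sH]]] := bounded_subseq bd.
  have cg : grad f (sval (cid (bad (s k)))) @[k --> \oo] --> grad f H.
    by apply: continuous_cvg sH; case: c11 => _ + _; exact.
  have lt1 : `|grad f H| < `|grad f H| + 1 by rewrite ltrDl.
  have [N _ hN] := cvgr_norm_le _ cg _ lt1.
  pose k := maxn N (Num.truncn (`|grad f H| + 1)).+1.
  have := hN k (leq_maxl _ _); rewrite /=; case: cid => x [_ /= kx].
  apply/negP; rewrite -ltNge (lt_trans _ kx)//.
  apply: (@lt_le_trans _ _ (Num.truncn (`|grad f H| + 1)).+1%:R); first exact: truncnS_gt.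
  by rewrite ler_nat (leq_trans _ (sk k))// leq_maxr.
exists (K + (B%:R + `|grad f x0|) / r).
  by rewrite addr_ge0// divr_ge0 ?addr_ge0// ltW.
move=> x xr; rewrite mulrDl; have [xin|xout] := ltP `|x - x0| r.
  rewrite ler_wpDr// ?mulr_ge0 ?addr_ge0 ?invr_ge0 ?(ltW r0)//.
  by apply: FK; rewrite -ball_normE/= ?subrr ?normr0// distrC.
rewrite ler_wpDl ?mulr_ge0// (le_trans (ler_normB _ _))//.
rewrite (le_trans (lerD (hB _ xr) (lexx _)))// -mulrA ler_peMr ?addr_ge0//.
by rewrite mulrC ler_pdivlMr// mul1r.
Qed.

Lemma strong_monotone_at x0 : C11 f ->
  (forall H, generalized_hessian f x0 H -> posdefmx H) ->
  exists m rho, [/\ 0 < m, 0 < rho & forall x, ball x0 rho x ->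
    m * dotp (x - x0) (x - x0) <= dotp (x - x0) (grad f x - grad f x0)].
Proof.
move=> c11 pd; have [r [K [r0 K0 FK]]] := C11_lipschitz x0 c11.
have [m [rho [m0 /andP[rho0 rhor] hm]]] := hessian_lower_bound r0 FK pd.
exists m, rho; split=> // x xin.
apply: (strong_monotone_ball K0 _ hm) => //; last exact: ballxx.
by move=> y z yr zr; apply: FK; [exact: le_ball yr|exact: le_ball zr].
Qed.

(** Strong monotonicity near [x0] propagates with a smaller constant: between
    [x0] and the point [x0 + tau (x - x0)] of the small ball the gradient gains
    along [x - x0], and by convexity of [f] it does not lose from there to [x]. *)
Lemma strong_monotone_bounded x0 rad : convex_function setT f -> C11 f ->
  (forall H, generalized_hessian f x0 H -> posdefmx H) ->
  exists2 m, 0 < m & forall x, `|x - x0| <= rad ->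
    m * dotp (x - x0) (x - x0) <= dotp (x - x0) (grad f x - grad f x0).
Proof.
move=> cf c11 pd; have [m [rho [m0 rho0 hm]]] := strong_monotone_at c11 pd.
have R1 : 0 < `|rad| + 1 by rewrite ltr_wpDl.
pose tau := Num.min (1 / 2) (rho / (`|rad| + 1)).
have tau0 : 0 < tau by rewrite lt_min !divr_gt0.
have tau1 : tau <= 1 / 2 by rewrite ge_min lexx.
have tau2 : tau * (`|rad| + 1) <= rho by rewrite -ler_pdivlMr// ge_min lexx orbT.
exists (m * tau); first exact: mulr_gt0.
move=> x xr; set v := x - x0; pose y := x0 + tau *: v.
have df z : differentiable f z by case: c11.
have : 0 <= dotp (x - y) (grad f x - grad f y) by exact: convex_grad_monotone.
have -> : x - y = (1 - tau) *: v.
  by rewrite /y /v scalerBl scale1r opprD addrA.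
rewrite dotpZl pmulr_rge0; last by lra.
have -> : grad f x - grad f y = (grad f x - grad f x0) - (grad f y - grad f x0).
  by rewrite opprB addrA subrK.
rewrite dotpDr dotpNr subr_ge0; apply: le_trans.
have := hm y; rewrite -ball_normE/= opprD addrA subrr sub0r normrN.
have -> : y - x0 = tau *: v by rewrite /y addrC addKr.
rewrite !dotpZl dotpZr normrZ (gtr0_norm tau0) => h.
rewrite -(ler_pM2l tau0) (le_trans _ (h _))//.
  by rewrite le_eqVlt; apply/orP; left; apply/eqP; ring.
rewrite (lt_le_trans _ tau2)// ltr_pM2l// (le_lt_trans xr)//.
by rewrite (le_lt_trans (ler_norm _))// ltrDl.
Qed.

End GradientBounds.

Section KKT.
Context {R : realType} {n p : nat}.
Variables (f : 'cV[R]_n -> R) (A : 'M[R]_(p, n)) (b : 'cV[R]_p) (mu : R).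
Hypotheses (mu_gt0 : 0 < mu) (cf : convex_function setT f)
  (df : forall x, differentiable f x).
Local Notation L := (aug_lagrangian f A b mu).

(** The gradient at a constrained minimizer is orthogonal to the kernel of [A],
    which the columns of [cokermx A] span; hence it lies in the row space. *)
Lemma kkt_multiplier x : solution_set f A b x -> exists l, grad f x + A^T *m l = 0.
Proof.
move=> [Axb xmin].
have : ((grad f x)^T <= A)%MS.
  rewrite submxE; apply/eqP/matrixP => i j; rewrite ord1 !mxE.
  rewrite (_ : \sum_k _ = dotp (grad f x) (col j (cokermx A))); last first.
    by apply: eq_bigr => k _; rewrite !mxE.
  apply: (fermat_direction (grad_expansion _ (df x))) => s; apply: xmin.
  by rewrite mulmxDr -scalemxAr colE mulmxA mulmx_coker mul0mx scaler0 addr0.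
move=> /submxP[D DA]; exists (- D^T).
by rewrite mulmxN -trmx_mul -DA trmxK subrr.
Qed.

(** Testing the left inequality at [l + (A x - b)] forces feasibility. Then the
    penalty term and its gradient vanish at [x], and the right inequality says
    that [x] is stationary for [f + <l, A - b>], which is convex. *)
Lemma saddle_pointsP x l :
  saddle_points L (x, l) <-> A *m x = b /\ grad f x + A^T *m l = 0.
Proof.
split=> [sp|[Axb gl] y k /=]; last first.
  rewrite /aug_lagrangian !enorm_sqr Axb subrr.
  have d0 w : dotp w 0 = 0 :> R by rewrite /dotp big1// => i _; rewrite mxE mulr0.
  rewrite !d0 mulr0 !addr0; split=> //.
  have := convex_grad_le y cf (df x).
  have -> : grad f x = - (A^T *m l) by apply/eqP; rewrite -addr_eq0 gl.
  rewrite dotpNl -dotp_mulmx mulmxBr Axb.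
  have : 0 <= (2 * mu)^-1 * dotp (A *m y - b) (A *m y - b).
    by rewrite mulr_ge0 ?dotp_ge0// invr_ge0 mulr_ge0// ltW.
  lra.
have Axb : A *m x = b.
  have [+ _] := sp x (l + (A *m x - b)).
  rewrite /aug_lagrangian/= lerD2l dotpDl gerDl => le0.
  apply/eqP; rewrite -subr_eq0; apply/eqP.
  have d0 : dotp (A *m x - b) (A *m x - b) = 0.
    by apply/eqP; rewrite eq_le le0 dotp_ge0.
  exact: dotp_eq0.
split=> //.
suff g0 v : dotp (grad f x + A^T *m l) v = 0.
  apply/matrixP => i j; rewrite ord1 [RHS]mxE -(g0 (delta_mx i 0)) /dotp (bigD1 i)//=.
  rewrite [delta_mx _ _ _ _]mxE !eqxx mulr1 big1 ?addr0// => k ki.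
  by rewrite [delta_mx _ _ _ _]mxE (negbTE ki) mulr0.
have := lagrangian_expansion A b l v (lt0r_neq0 mu_gt0) (df x).
rewrite Axb subrr mulmx0 scaler0 addr0 => ex.
apply: (@fermat_direction _ _ (L^~ l) x v _ ex) => s.
by have [_] := sp (x + s *: v) l.
Qed.

End KKT.

(** * Linear bounds and differential inequalities *)

Section LinearBounds.
Context {R : realType}.

Lemma sqr_norm_le_dotp n (u : 'cV[R]_n) : `|u| ^+ 2 <= dotp u u.
Proof.
rewrite -(sqr_sqrtr (dotp_ge0 u)) lerXn2r ?nnegrE ?sqrtr_ge0//.
apply: normm_le => [|i j]; first exact: sqrtr_ge0.
rewrite ord1 -sqrtr_sqr ler_wsqrtr// /dotp (bigD1 i)//= -expr2 lerDl.
by apply: sumr_ge0 => k _; rewrite -expr2 sqr_ge0.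
Qed.

Lemma dotp_le_sqr_norm n (u : 'cV[R]_n) : dotp u u <= n%:R * `|u| ^+ 2.
Proof.
by rewrite (le_trans (ler_norm _))// (le_trans (dotp_norm_le _ _))// expr2 mulrA.
Qed.

Lemma dotp_mulmx_le n q (M : 'M[R]_(q, n)) : exists2 C, 0 <= C &
  forall v, dotp (M *m v) (M *m v) <= C * dotp v v.
Proof.
exists (q%:R * (n%:R * `|M|) ^+ 2); first by rewrite mulr_ge0 ?sqr_ge0.
move=> v; rewrite (le_trans (dotp_le_sqr_norm _))// -mulrA ler_wpM2l//.
rewrite (le_trans _ (ler_wpM2l (sqr_ge0 _) (sqr_norm_le_dotp v)))//.
by rewrite -exprMn lerXn2r ?nnegrE ?mulr_ge0// norm_mulmx_le.
Qed.

(** A right inverse of [A] bounds [l] by [A^T l]. *)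
Lemma row_free_tr_bound n p (A : 'M[R]_(p, n)) : row_free A -> exists2 C, 0 < C &
  forall l, dotp l l <= C * dotp (A^T *m l) (A^T *m l).
Proof.
move=> /row_freeP[B AB]; have [C C0 hC] := dotp_mulmx_le B^T.
exists (C + 1); first by rewrite ltr_wpDl.
move=> l; have {1 2}-> : l = B^T *m (A^T *m l) by rewrite mulmxA -trmx_mul AB trmx1 mul1mx.
by rewrite (le_trans (hC _))// ler_wpM2r ?dotp_ge0// lerDl.
Qed.

End LinearBounds.

Section Calculus.
Context {R : realType}.

Lemma is_derive_entry n (u : R -> 'cV[R]_n) t du i :
  is_derive t (1 : R) u du -> is_derive t (1 : R) (fun s => u s i 0) (du i 0).
Proof.
move=> [/[dup] dd /derivable_mxP/(_ i 0) di]; rewrite derive_mx// => <-.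
by split => //; rewrite mxE.
Qed.

Lemma is_derive_dotp_mulmx n q (M : 'M[R]_(q, n)) (u : R -> 'cV[R]_q)
    (v : R -> 'cV[R]_n) t du dv :
  is_derive t (1 : R) u du -> is_derive t (1 : R) v dv ->
  is_derive t (1 : R) (fun s => dotp (u s) (M *m v s))
    (dotp du (M *m v t) + dotp (u t) (M *m dv)).
Proof.
move=> hu hv.
have Mv i : is_derive t (1 : R) (fun s => (M *m v s) i 0) ((M *m dv) i 0).
  have -> : (fun s => (M *m v s) i 0) = \sum_(j < n) (fun s => M i j * v s j 0).
    by apply/funext => s; rewrite fct_sumE mxE.
  rewrite mxE; apply: is_derive_sum => j.
  exact: (is_deriveZ (M i j) (is_derive_entry j hv)).
have -> : (fun s => dotp (u s) (M *m v s)) =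
    \sum_(i < q) ((fun s => u s i 0) * (fun s => (M *m v s) i 0)).
  by apply/funext => s; rewrite fct_sumE.
have -> : dotp du (M *m v t) + dotp (u t) (M *m dv) = \sum_(i < q)
    (u t i 0 *: (M *m dv) i 0 + (M *m v t) i 0 *: du i 0).
  rewrite addrC -big_split; apply: eq_bigr => i _.
  by rewrite /GRing.scale/= [X in _ + X]mulrC.
by apply: is_derive_sum => i; exact: (is_deriveM (is_derive_entry i hu) (Mv i)).
Qed.

Lemma continuous_dotp_mulmx n q (T : topologicalType) (M : 'M[R]_(q, n))
    (u : T -> 'cV[R]_q) (v : T -> 'cV[R]_n) :
  continuous u -> continuous v -> continuous (fun s => dotp (u s) (M *m v s)).
Proof.
move=> cu cv x; apply: cvg_sum_fin => i; apply: cvgM.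
  exact: (cvg_comp _ _ (cu x) (@coord_continuous _ _ _ i 0 (u x))).
rewrite mxE; under eq_fun do rewrite mxE.
apply: cvg_sum_fin => j; apply: cvgM; first exact: cvg_cst.
exact: (cvg_comp _ _ (cv x) (@coord_continuous _ _ _ j 0 (v x))).
Qed.

(** [expR (kappa t) V t] is nonincreasing. *)
Lemma gronwall_decay (V V' : R -> R) (kappa : R) :
  {within `[0, +oo[, continuous V} ->
  (forall t : R, 0 < t -> is_derive t (1 : R) V (V' t)) ->
  (forall t : R, 0 < t -> V' t <= - kappa * V t) ->
  forall t : R, 0 <= t -> V t <= expR (- kappa * t) * V 0.
Proof.
move=> cV dV decay t t0.
pose W s := expR (kappa * s) * V s.
have dW (s : R) : 0 < s -> is_derive s (1 : R) W
    (expR (kappa * s) * V' s + V s * (expR (kappa * s) * kappa)).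
  move=> s0; have dk : is_derive s (1 : R) (fun s => expR (kappa * s)) (expR (kappa * s) * kappa).
    have dl : is_derive s (1 : R) (fun s => kappa * s) kappa.
      have := is_deriveZ kappa (is_derive_id s (1 : R)).
      by rewrite [kappa *: 1]mulr1.
    exact: (is_derive1_comp (is_derive_expR _) dl).
  exact: (is_deriveM dk (dV s s0)).
have Wle : W t <= W 0.
  apply: (@ler0_derive1_nincry _ W 0) => //.
  - by move=> s; rewrite in_itv/= andbT => /dW[].
  - move=> s; rewrite in_itv/= andbT => s0; have [_] := dW s s0.
    rewrite derive1E => ->; have := decay s s0; have := expR_gt0 (kappa * s).
    move=> E0 h; rewrite (_ : _ + _ = expR (kappa * s) * (V' s + kappa * V s)); last by ring.
    by rewrite pmulr_rle0//; lra.
  - move=> s; apply: cvgM; last exact: cV.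
    have ce : continuous (fun s => expR (kappa * s)).
      move=> r; apply: (@continuous_comp _ _ _ ( *%R kappa) expR).
        exact: mulrl_continuous.
      exact: continuous_expR.
    exact: continuous_subspaceT.
move: Wle; rewrite /W mulr0 expR0 mul1r => Wle.
rewrite -(ler_pM2l (expR_gt0 (kappa * t))) mulrA -expRD mulNr subrr expR0 mul1r.
exact: Wle.
Qed.

End Calculus.

(** * Decay of the energy along the saddle-point flow *)

Lemma norm_dotp_young (R : realType) n (u v : 'cV[R]_n) :
  `|dotp u v| <= (dotp u u + dotp v v) / 2.
Proof.
have := dotp_ge0 (u + v); have := dotp_ge0 (u - v).
rewrite !(dotpDl, dotpDr, dotpNl, dotpNr) (dotpC v u) ler_norml => ? ?.
by apply/andP; split; lra.
Qed.

Section SaddleFlow.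
Context {R : realType} {n p : nat}.
Variables (f : 'cV[R]_n -> R) (A : 'M[R]_(p, n)) (b : 'cV[R]_p) (mu : R).
Variables (xs : 'cV[R]_n) (ls : 'cV[R]_p).
Hypotheses (mu_gt0 : 0 < mu) (cf : convex_function setT f) (c11 : C11 f)
  (pd : forall H, generalized_hessian f xs H -> posdefmx H)
  (rankA : \rank A = p)
  (Axs : A *m xs = b) (kkt : grad f xs + A^T *m ls = 0).
Local Notation L := (aug_lagrangian f A b mu).

Let df x : differentiable f x. Proof. by case: c11. Qed.

(** The velocity of [x], written so that it visibly vanishes at the equilibrium
    [(xs, ls)]. *)
Definition saddle_velocity (x : 'cV[R]_n) (l : 'cV[R]_p) : 'cV[R]_n :=
  - (grad f x - grad f xs + mu^-1 *: (A^T *m (A *m (x - xs))) + A^T *m (l - ls)).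

Lemma grad_lagrangian_centered x l : - grad (L^~ l) x = saddle_velocity x l.
Proof.
rewrite grad_lagrangian_x ?lt0r_neq0// /saddle_velocity; congr (- _).
have -> : grad f xs = - (A^T *m ls) by apply/eqP; rewrite -addr_eq0 kkt.
by rewrite -Axs -mulmxBr (mulmxBr A^T l) opprK; apply/matrixP => i j; rewrite !mxE; ring.
Qed.

Definition saddle_energy (x : 'cV[R]_n) (l : 'cV[R]_p) :=
  dotp (x - xs) (x - xs) + dotp (l - ls) (l - ls).

(** Half the derivative of the energy along the flow: the coupling between [x]
    and [l] is skew and cancels, so that nothing is dissipated in [l]. *)
Lemma energy_rate x l :
  dotp (x - xs) (saddle_velocity x l) + dotp (l - ls) (A *m (x - xs)) =
  - dotp (x - xs) (grad f x - grad f xs)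
  - mu^-1 * dotp (A *m (x - xs)) (A *m (x - xs)).
Proof.
rewrite /saddle_velocity; set u := x - xs; set k := l - ls; set g := _ - grad f xs.
clearbody u k g.
rewrite dotpNr !dotpDr dotpZr !(dotp_mulmx A^T) !trmxK (dotp_mulmx A k).
by rewrite (dotpC (A *m u) k) (dotp_mulmx A k); ring.
Qed.

Lemma energy_rate_le0 x l :
  dotp (x - xs) (saddle_velocity x l) + dotp (l - ls) (A *m (x - xs)) <= 0.
Proof.
rewrite energy_rate; have := convex_grad_monotone cf (df x) (df xs).
have : 0 <= mu^-1 * dotp (A *m (x - xs)) (A *m (x - xs)).
  by rewrite mulr_ge0 ?dotp_ge0// invr_ge0 ltW.
lra.
Qed.

(** The derivative of [<l - ls, A (x - xs)>] contains the missing dissipation in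
    [l], as [- |A^T (l - ls)|^2]; half of it absorbs the products with the terms
    in [x]. *)
Lemma cross_rate_le x l :
  dotp (A *m (x - xs)) (A *m (x - xs)) + dotp (l - ls) (A *m saddle_velocity x l) <=
  dotp (A *m (x - xs)) (A *m (x - xs)) +
  dotp (grad f x - grad f xs) (grad f x - grad f xs) +
  dotp (mu^-1 *: (A^T *m A) *m (x - xs)) (mu^-1 *: (A^T *m A) *m (x - xs))
  - dotp (A^T *m (l - ls)) (A^T *m (l - ls)) / 2.
Proof.
rewrite (dotp_mulmx A (l - ls)) /saddle_velocity; set u := x - xs; set q := A^T *m _.
set g := _ - grad f xs.
have -> : mu^-1 *: (A^T *m A) *m u = mu^-1 *: (A^T *m (A *m u)).
  by rewrite -scalemxAl mulmxA.
set w := mu^-1 *: _; clearbody g q w.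
have := dotp_ge0 (q + (g + w)); have := dotp_ge0 (g - w).
rewrite dotpNr !(dotpDl, dotpDr, dotpNl, dotpNr) (dotpC g q) (dotpC w q) (dotpC w g).
lra.
Qed.

Section Solution.
Variables (z0 : 'cV[R]_n * 'cV[R]_p) (x : R -> 'cV[R]_n) (l : R -> 'cV[R]_p).
Hypothesis sol : saddle_solution L z0 x l.

Lemma solution_is_derive (t : R) : 0 < t ->
  is_derive t (1 : R) (fun s => x s - xs) (saddle_velocity (x t) (l t)) /\
  is_derive t (1 : R) (fun s => l s - ls) (A *m (x t - xs)).
Proof.
case: sol => _ _ h t0; have [dx dl] := h t t0; split.
  rewrite -[saddle_velocity _ _]subr0 -grad_lagrangian_centered.
  exact: (is_deriveB dx (is_derive_cst xs t 1)).
rewrite mulmxBr Axs -[_ - b]subr0 -(grad_lagrangian_l f A b mu (x t) (l t)).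
exact: (is_deriveB dl (is_derive_cst ls t 1)).
Qed.

Lemma solution_continuous :
  {within `[0, +oo[, continuous (fun s => x s - xs)} /\
  {within `[0, +oo[, continuous (fun s => l s - ls)}.
Proof.
by case: sol => _ [cx cl] _; split=> t; apply: cvgB;
  [exact: cx|exact: cvg_cst|exact: cl|exact: cvg_cst].
Qed.

Lemma lyapunov_is_derive (eps t : R) : 0 < t ->
  is_derive t (1 : R) (fun s => saddle_energy (x s) (l s) / 2 +
      eps * dotp (l s - ls) (A *m (x s - xs)))
    (dotp (x t - xs) (saddle_velocity (x t) (l t)) + dotp (l t - ls) (A *m (x t - xs)) +
     eps * (dotp (A *m (x t - xs)) (A *m (x t - xs)) +
            dotp (l t - ls) (A *m saddle_velocity (x t) (l t)))).
Proof.
move=> t0; have [dx dl] := solution_is_derive t0.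
have := is_deriveD (is_deriveZ 2^-1 (is_deriveD (is_derive_dotp_mulmx 1%:M dx dx)
  (is_derive_dotp_mulmx 1%:M dl dl))) (is_deriveZ eps (is_derive_dotp_mulmx A dl dx)).
rewrite (_ : _ + _ = (fun s => saddle_energy (x s) (l s) / 2 +
    eps * dotp (l s - ls) (A *m (x s - xs)))); last first.
  by apply/funext => s; rewrite !fctE/= /saddle_energy !mul1mx [X in X + _]mulrC.
rewrite !mul1mx (dotpC (saddle_velocity _ _)) (dotpC (A *m _) (l t - ls)).
set v := dotp _ (saddle_velocity _ _); set w := dotp (l t - ls) (A *m (x t - xs)).
move=> D; apply: (is_derive_eq D).
by rewrite /GRing.scale/=; field.
Qed.

Lemma lyapunov_continuous (eps : R) :
  {within `[0, +oo[, continuous (fun s => saddle_energy (x s) (l s) / 2 +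
      eps * dotp (l s - ls) (A *m (x s - xs)))}.
Proof.
have [cx cl] := solution_continuous => t.
have E1 := continuous_dotp_mulmx (M := 1%:M) cx cx.
have E2 := continuous_dotp_mulmx (M := 1%:M) cl cl.
have E3 := continuous_dotp_mulmx (M := A) cl cx.
apply: cvgD.
  apply: cvgM; last exact: cvg_cst.
  have E s : saddle_energy (x s) (l s) = dotp (x s - xs) (1%:M *m (x s - xs)) +
      dotp (l s - ls) (1%:M *m (l s - ls)) by rewrite !mul1mx.
  rewrite (funext E : (fun s => saddle_energy (x s) (l s)) = _) (E t).
  by apply: cvgD; [exact: (E1 t)|exact: (E2 t)].
by apply: cvgM; [exact: cvg_cst|exact: (E3 t)].
Qed.

(** Trajectories stay in the bounded region determined by their initial energy,
    on which the constants of strong monotonicity and growth are fixed. *)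
Lemma energy_nonincreasing (t : R) : 0 <= t ->
  saddle_energy (x t) (l t) <= saddle_energy (x 0) (l 0).
Proof.
move=> t0.
have := gronwall_decay (lyapunov_continuous (eps := 0)) (lyapunov_is_derive 0) (kappa := 0) _ t0.
rewrite oppr0 !mul0r expR0 !addr0 mul1r => h.
rewrite -(ler_pM2r (_ : 0 < 2^-1)) ?invr_gt0//; apply: h => s s0.
by rewrite !mul0r addr0; exact: energy_rate_le0.
Qed.

End Solution.

(** Lyapunov function: half the energy plus a small multiple [eps] of the cross
    term. It is comparable to the energy when [eps (a + 1) <= 1/2], and its
    derivative is bounded by [- kappa] times the energy when
    [eps (P + 1) <= m / 2], where [P] collects the bounds on the terms in [x] that
    the cross term produces. *)
Lemma energy_exponential_decay S : 0 <= S -> exists2 kappa, 0 < kappa &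
  forall z0 x l, saddle_solution L z0 x l -> saddle_energy z0.1 z0.2 <= S ->
  forall t : R, 0 <= t ->
    saddle_energy (x t) (l t) <= 4 * expR (- kappa * t) * saddle_energy z0.1 z0.2.
Proof.
move=> S0.
have [m m0 hm] := strong_monotone_bounded (S + 1) cf c11 pd.
have [K K0 hK] := grad_growth xs (S + 1) c11.
have [a a0 ha] := dotp_mulmx_le A.
have [c c0 hc] := dotp_mulmx_le (mu^-1 *: (A^T *m A)).
have [C C0 hC] : exists2 C, 0 < C & forall l, dotp l l <= C * dotp (A^T *m l) (A^T *m l).
  by apply: row_free_tr_bound; rewrite /row_free rankA.
pose P := a + n%:R * K ^+ 2 + c.
have P0 : 0 <= P by rewrite /P !addr_ge0// mulr_ge0// sqr_ge0.
have P1 : 0 < P + 1 by rewrite ltr_wpDl.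
pose eps := Num.min (2^-1) (Num.min (m / 2 / (P + 1)) (2^-1 / (a + 1))).
have a1 : 0 < a + 1 by rewrite ltr_wpDl.
have eps0 : 0 < eps by rewrite !lt_min invr_gt0 ltr0n/= !divr_gt0.
have eps1 : eps <= 2^-1 by rewrite ge_min lexx.
have eps2 : eps * (P + 1) <= m / 2 by rewrite -ler_pdivlMr// !ge_min lexx !orbT.
have eps3 : eps * (a + 1) <= 2^-1 by rewrite -ler_pdivlMr// !ge_min lexx !orbT.
pose kappa := Num.min (m / 2) (eps / 2 / C).
have kappa0 : 0 < kappa by rewrite lt_min !divr_gt0.
have k1 : kappa <= m / 2 by rewrite ge_min lexx.
have k2 : kappa * C <= eps / 2 by rewrite -ler_pdivlMr// ge_min lexx orbT.
exists kappa => // z0 x l sol ES t t0.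
have [z0E _ _] := sol.
have {}z0E : saddle_energy z0.1 z0.2 = saddle_energy (x 0) (l 0) by rewrite -z0E.
rewrite z0E in ES *.
pose V s := saddle_energy (x s) (l s) / 2 + eps * dotp (l s - ls) (A *m (x s - xs)).
have cross s : `|eps * dotp (l s - ls) (A *m (x s - xs))| <= saddle_energy (x s) (l s) / 4.
  rewrite normrM gtr0_norm//; set k := l s - ls; set y := A *m _.
  have h1 := norm_dotp_young k y.
  have h2 := ha (x s - xs); rewrite -/y in h2.
  have h3 := dotp_ge0 k; have h4 := dotp_ge0 (x s - xs).
  rewrite (le_trans (ler_wpM2l (ltW eps0) h1))// /saddle_energy -/k; nra.
have Vup s : V s <= saddle_energy (x s) (l s).
  have := cross s; rewrite ler_norml /V => /andP[_ ?].
  have : 0 <= saddle_energy (x s) (l s) by rewrite addr_ge0 ?dotp_ge0.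
  lra.
have Vlow s : saddle_energy (x s) (l s) <= 4 * V s.
  by have := cross s; rewrite ler_norml /V => /andP[? _]; lra.
have decay := gronwall_decay (lyapunov_continuous sol (eps := eps))
  (lyapunov_is_derive sol eps) (kappa := kappa) _ t0.
rewrite (le_trans (Vlow t))// -mulrA ler_pM2l//.
rewrite (le_trans (decay _))//; last by rewrite ler_wpM2l ?expR_ge0// Vup.
move=> s s0; rewrite -/(V s).
have xin : `|x s - xs| <= S + 1.
  have : `|x s - xs| ^+ 2 <= S.
    rewrite (le_trans (sqr_norm_le_dotp _))// (le_trans _ ES)//.
    rewrite (le_trans _ (energy_nonincreasing sol (ltW s0)))//.
    by rewrite /saddle_energy lerDl dotp_ge0.
  by have := normr_ge0 (x s - xs); move: `|_| => N; nra.
have e1 := energy_rate (x s) (l s).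
have e2 := cross_rate_le (x s) (l s).
have e3 := hm _ xin.
have e4 : dotp (grad f (x s) - grad f xs) (grad f (x s) - grad f xs) <=
    n%:R * K ^+ 2 * dotp (x s - xs) (x s - xs).
  rewrite (le_trans (dotp_le_sqr_norm _))// -mulrA ler_wpM2l//.
  rewrite (le_trans _ (ler_wpM2l (sqr_ge0 _) (sqr_norm_le_dotp _)))//.
  by rewrite -exprMn lerXn2r ?nnegrE ?mulr_ge0// hK.
have e5 := ha (x s - xs); have e6 := hc (x s - xs); have e7 := hC (l s - ls).
have e8 : 0 <= mu^-1 * dotp (A *m (x s - xs)) (A *m (x s - xs)).
  by rewrite mulr_ge0 ?dotp_ge0// invr_ge0 ltW.
have := Vup s; rewrite /saddle_energy.
have := dotp_ge0 (x s - xs); have := dotp_ge0 (l s - ls).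
have := dotp_ge0 (A^T *m (l s - ls)).
rewrite e1; move: (V s) e2 e3 e4 e5 e6 e7 e8; rewrite /P in eps2.
set X := dotp (x s - xs) (x s - xs); set La := dotp (l s - ls) (l s - ls).
set Y := dotp (A *m _) (A *m _); set Q := dotp (A^T *m _) (A^T *m _).
set D := dotp (l s - ls) (A *m _); set Ph := dotp (grad _ _ - _) (_ - _).
set W := dotp (_ *: _ *m _) _; set Sp := dotp (x s - xs) (_ - _).
clearbody X La Y Q D Ph W Sp.
move=> v e2 e3 e4 e5 e6 e7 e8 Q0 La0 X0 vle.
have PX : Y + Ph + W <= (a + n%:R * K ^+ 2 + c) * X by rewrite !mulrDl !lerD.
have h1 : eps * (Y + D) <= eps * ((a + n%:R * K ^+ 2 + c) * X - Q / 2).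
  by rewrite ler_wpM2l ?(ltW eps0)//; lra.
have h2 : eps * (a + n%:R * K ^+ 2 + c) * X <= m / 2 * X.
  by rewrite ler_wpM2r// (le_trans _ eps2)// ler_wpM2l ?(ltW eps0)// lerDl.
have h3 : kappa * X <= m / 2 * X by rewrite ler_wpM2r.
have h4 : kappa * La <= eps / 2 * Q.
  rewrite (le_trans (ler_wpM2l (ltW kappa0) e7))// mulrA ler_wpM2r//.
have h5 : kappa * v <= kappa * (X + La) by rewrite ler_wpM2l// ltW.
lra.
Qed.

End SaddleFlow.

(** * Stability of the saddle point *)

Lemma dist_set1 (R : realType) n p (z s : 'cV[R]_n * 'cV[R]_p) :
  dist_set z [set s] = Num.sqrt (saddle_energy s.1 s.2 z.1 z.2).
Proof. by rewrite /dist_set image_set1 inf1 /enorm_pair !enorm_sqr. Qed.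

(** Two stationary pairs have gradients of [f] that differ by an element of the
    range of [A^T], which is orthogonal to the difference of the feasible points;
    strong monotonicity makes these points equal, and then injectivity of [A^T]
    the multipliers. *)
Lemma saddle_points_singleton (R : realType) n p (f : 'cV[R]_n -> R)
    (A : 'M[R]_(p, n)) b mu xs ls :
  0 < mu -> convex_function setT f -> C11 f -> \rank A = p ->
  (forall H, generalized_hessian f xs H -> posdefmx H) ->
  A *m xs = b -> grad f xs + A^T *m ls = 0 ->
  saddle_points (aug_lagrangian f A b mu) = [set (xs, ls)].
Proof.
move=> mu0 cf c11 rankA pd Axs kkt; have df x : differentiable f x by case: c11.
apply/seteqP; split => [[x l]|_ ->]; last exact/(saddle_pointsP _ _ mu0 cf df).
move=> /(saddle_pointsP _ _ mu0 cf df)[Ax gx].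
have [m m0 hm] := strong_monotone_bounded `|x - xs| cf c11 pd.
have gE : grad f x - grad f xs = A^T *m (ls - l).
  have -> : grad f x = - (A^T *m l) by apply/eqP; rewrite -addr_eq0 gx.
  have -> : grad f xs = - (A^T *m ls) by apply/eqP; rewrite -addr_eq0 kkt.
  by rewrite mulmxBr opprK addrC.
have x0 : x - xs = 0.
  apply: dotp_eq0; apply/eqP; rewrite eq_le dotp_ge0 andbT.
  have := hm x (lexx _); rewrite gE dotp_mulmx trmxK mulmxBr Ax Axs subrr.
  by rewrite /dotp [X in _ <= X]big1 ?pmulr_rle0// => i _; rewrite mxE mul0r.
have [C C0 hC] := row_free_tr_bound (A := A) (introT eqP rankA).
have l0 : ls - l = 0.
  apply: dotp_eq0; apply/eqP; rewrite eq_le dotp_ge0 andbT (le_trans (hC _))//.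
  rewrite -gE (_ : x = xs); last by apply/eqP; rewrite -subr_eq0 x0.
  by rewrite subrr /dotp big1 ?mulr0// => i _; rewrite mxE mul0r.
by congr pair; apply/eqP; rewrite -subr_eq0 ?x0// -opprB l0 oppr0.
Qed.

Theorem theorem3p6 (R : realType) (n p : nat) (f : 'cV[R]_n -> R)
    (A : 'M[R]_(p, n)) (b : 'cV[R]_p) (mu : R)
    (f_convex : convex_function setT f)
    (le_pn : (p <= n)%N)
    (rankA : \rank A = p)
    (sol_nonempty : solution_set f A b !=set0)
    (sol_bounded : bounded_set (solution_set f A b))
    (mu_gt0 : 0 < mu) (mu_lt1 : mu < 1)
    (f_C11 : C11 f)
    (f_posdef : forall x H, generalized_hessian f x H -> posdefmx H) :
  let L := aug_lagrangian f A b mu in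
  (exists z, saddle_points L = [set z]) /\
  exponentially_stable L (saddle_points L).
Proof.
move=> L; have df x : differentiable f x by case: f_C11.
have [xs sxs] := sol_nonempty; have [Axs _] := sxs.
have [ls kkt] := kkt_multiplier df sxs.
have spE := saddle_points_singleton mu_gt0 f_convex f_C11 rankA (@f_posdef xs) Axs kkt.
rewrite -/L in spE; split; first by exists (xs, ls).
move=> B [M0 [_ BM]]; pose M := `|M0| + 1.
have {}BM z : B z -> `|z| <= M.
  by move=> Bz; apply: (BM M) => //; rewrite (le_lt_trans (ler_norm M0))// ltrDl.
have M_ge0 : 0 <= M by rewrite /M addr_ge0.
pose S := n%:R * (M + `|xs|) ^+ 2 + p%:R * (M + `|ls|) ^+ 2.
have S0 : 0 <= S by apply: addr_ge0; apply: mulr_ge0 => //; exact: sqr_ge0.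
have [kappa kappa0 decay] := energy_exponential_decay mu_gt0 f_convex f_C11
  (@f_posdef xs) rankA Axs kkt S0.
exists 2, (kappa / 2); split; rewrite ?divr_gt0//.
move=> z0 x l Bz0 sol t t0; rewrite spE !dist_set1/=.
have ES : saddle_energy xs ls z0.1 z0.2 <= S.
  have := BM z0 Bz0; rewrite prod_normE ge_max => /andP[n1 n2].
  have le q (u v : 'cV[R]_q) : `|u| <= M -> dotp (u - v) (u - v) <= q%:R * (M + `|v|) ^+ 2.
    move=> uM; rewrite (le_trans (dotp_le_sqr_norm _))// ler_wpM2l//.
    by rewrite lerXn2r ?nnegrE ?addr_ge0// (le_trans (ler_normB _ _))// lerD2r.
  by rewrite lerD// le.
have := decay z0 x l sol ES t t0.
have -> : 4 * expR (- kappa * t) = (2 * expR (- (kappa / 2) * t)) ^+ 2.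
  by rewrite exprMn -expRM_natl; congr (_ * expR _); [ring|field].
by move=> /ler_wsqrtr; rewrite sqrtrM ?sqr_ge0// sqrtr_sqr ger0_norm.
Qed.
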